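(* Let $\mathcal{A}$ be an abelian length category and let $L := \mathsf{tors}\,\mathcal{A}$ be its lattice of torsion classes. Then there are isomorphisms of posets: (1) $\mathsf{tors\text{-}heart}\,\mathcal{A} \cong \{\, \mathsf{j\text{-}label}[a,b] \mid [a,b] \text{ an interval in } L \,\}$; (2) $\mathsf{wide}\,\mathcal{A} \cong \{\, \mathsf{j\text{-}label}[a,b] \mid [a,b] \text{ a wide interval in } L \,\}$; (3) $\mathsf{ice}\,\mathcal{A} \cong \{\, \mathsf{j\text{-}label}[a,b] \mid [a,b] \text{ an ICE interval in } L \,\}$. Here each right-hand side is a set of subsets of $\mathsf{j\text{-}irr}^c L$, partially ordered by inclusion.
   Context: Conventions: all categories are skeletally small; all subcategories are full, closed under isomorphisms and nonempty. An abelian length category is an abelian category in which every object has a composition series. Subcategories of $\mathcal{A}$. A torsion class is a subcategory closed under extensions and quotients in $\mathcal{A}$; $\mathsf{tors}\,\mathcal{A}$ is the poset of torsion classes ordered by inclusion (it is a complete lattice with meet given by intersection, and it is completely semidistributive in the sense below). For a collection $\mathcal{C}$ of objects, $\mathcal{C}^\perp := \{M \mid \mathcal{A}(C,M)=0\ \forall C\in\mathcal{C}\}$. For torsion classes $\mathcal{U}\subseteq\mathcal{T}$, the heart of the interval $[\mathcal{U},\mathcal{T}]$ is $\mathcal{H}_{[\mathcal{U},\mathcal{T}]} := \mathcal{T}\cap\mathcal{U}^\perp$. A torsion heart is a subcategory of the form $\mathcal{H}_{[\mathcal{U},\mathcal{T}]}$; $\mathsf{tors\text{-}heart}\,\mathcal{A}$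 is the poset of torsion hearts. A wide subcategory is a subcategory closed under extensions, kernels and cokernels; an ICE-closed subcategory is one closed under images, cokernels and extensions (closed under kernels/cokernels/images means that for every morphism of $\mathcal{A}$ between objects of the subcategory, its kernel/cokernel/image lies in the subcategory). $\mathsf{wide}\,\mathcal{A}$ and $\mathsf{ice}\,\mathcal{A}$ are the posets of these. All posets of subcategories are ordered by inclusion. Lattices. A complete lattice $L$ is completely semidistributive if for all $a,b\in L$ and $X\subseteq L$: $a\vee x=b$ for every $x\in X$ implies $a\vee\bigwedge X=b$, and $a\wedge x=b$ for every $x\in X$ implies $a\wedge\bigvee X=b$ (for nonempty $X$). An element $j$ is completely join-irreducible if $j=\bigvee X$ implies $j\in X$; $\mathsf{j\text{-}irr}^c L$ is the set of such elements. Each $j\in\mathsf{j\text{-}irr}^c L$ covers a unique element $j_*=\bigvee\{x\mid x<j\}$, and $\kappa(j):=\max\{x\in L\mid j\wedge x=j_*\}$ (this maximum exists). Write $a\lessdot a'$ if $a'$ covers $a$. For $a\le b$ in $L$, put $$\mathsf{j\text{-}label}[a,b]:=\{j\in\mathsf{j\text{-}irr}^c L\mid j\le b\text{ and }\kappa(j)\ge a\}.$$ An interval $[a,b]$ (with $a\le b$) is a wide interval if $b=a\vee\bigvee\{a'\in L\mid a\lessdot a'\le b\}$, and an ICE interval if $b\le a\vee\bigvee\{a'\in L\mid a\lessdot a'\}$. *)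

(* Defs.v *)
From HB Require Import structures.
From mathcomp Require Import all_boot all_order all_algebra.
From mathcomp Require Import boolp classical_sets functions.
Import Order.TTheory GRing.Theory.

Set Implicit Arguments.
Unset Strict Implicit.
Unset Printing Implicit Defensive.

Local Open Scope classical_set_scope.
Local Open Scope order_scope.

(* [X] and [Y] carry the order induced from [P] and [Q]; the values of [f]
   outside [X] are irrelevant. *)
Definition order_isomorphic d d' (P : porderType d) (Q : porderType d')
    (X : set P) (Y : set Q) : Prop :=
  exists f : P -> Q, set_bij X Y f /\ {in X &, {mono f : x y / x <= y}}.

HB.mixin Record POrder_hasBigMeetJoin d L of Order.POrder d L := {
  bigmeet : set L -> L;
  bigjoin : set L -> L;
  bigmeetP : forall X, infimums X (bigmeet X);
  bigjoinP : forall X, supremums X (bigjoin X);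
}.

#[short(type="completeLatticeType")]
HB.structure Definition CompleteLattice d :=
  {L of Order.TBLattice d L & POrder_hasBigMeetJoin d L}.

HB.factory Record POrder_hasInfimums d L of Order.POrder d L := {
  inf : set L -> L;
  infP : forall X, infimums X (inf X);
}.

HB.builders Context d L of POrder_hasInfimums d L.

Let sup (X : set L) : L := inf (ubound X).

Let supP X : supremums X (sup X).
Proof.
have [lb glb] := infP (ubound X).
by split=> [x Xx|y uy]; [apply: glb => y uy; exact: uy | exact: lb].
Qed.

HB.instance Definition _ := POrder_hasBigMeetJoin.Build d L infP supP.

Let lexI x y z : (x <= inf [set y; z]) = (x <= y) && (x <= z).
Proof.
have [lb glb] := infP [set y; z]; apply/idP/andP => [xi|[xy xz]].
  by split; apply: (le_trans xi); apply: lb; [left|right].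
by apply: glb => _ [->|->].
Qed.

Let leUx x y z : (sup [set x; y] <= z) = (x <= z) && (y <= z).
Proof.
have [ub lub] := supP [set x; y]; apply/idP/andP => [sz|[xz yz]].
  by split; apply: le_trans sz; apply: ub; [left|right].
by apply: lub => _ [->|->].
Qed.

HB.instance Definition _ := Order.POrder_MeetJoin_isLattice.Build d L lexI leUx.

Let le0x x : inf setT <= x.
Proof. by case: (infP setT) => lb _; exact: lb. Qed.

Let lex1 x : x <= sup setT.
Proof. by case: (supP setT) => ub _; exact: ub. Qed.

HB.instance Definition _ := Order.hasBottom.Build d L le0x.
HB.instance Definition _ := Order.hasTop.Build d L lex1.

HB.end.

Section LatticeLabels.
Context d (L : completeLatticeType d).
Implicit Types (a b j x : L).

Definition covered a b : Prop := a < b /\ forall x, ~~ (a < x < b).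

(* [X] may be empty, so that the bottom element does not qualify. *)
Definition cjoin_irr : set L := [set j | forall X, j = bigjoin X -> X j].

Definition lower_cover j : L := bigjoin [set x | x < j].

Definition maximums (X : set L) : set L := X `&` ubound X.

(* The default value [j] of [xget] is returned only if there is no maximum; one
   always exists for [j] completely join-irreducible in a completely
   semidistributive lattice. *)
Definition kappa j : L := xget j (maximums [set x | j `&` x = lower_cover j]).

Definition j_label a b : set L :=
  [set j | [/\ cjoin_irr j, j <= b & a <= kappa j]].

Definition any_interval a b : Prop := a <= b.

Definition wide_interval a b : Prop :=
  a <= b /\ b = a `|` bigjoin [set a' | covered a a' /\ a' <= b].

Definition ice_interval a b : Prop :=
  a <= b /\ b <= a `|` bigjoin [set a' | covered a a'].

Definition j_labels (I : L -> L -> Prop) : set (set L) :=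
  [set J | exists a b, I a b /\ J = j_label a b].

End LatticeLabels.

Record preadditiveCat := PreadditiveCat {
  obj :> Type;
  hom : obj -> obj -> zmodType;
  idm : forall X, hom X X;
  cmp : forall X Y Z, hom Y Z -> hom X Y -> hom X Z;
  cmpA : forall W X Y Z (h : hom Y Z) (g : hom X Y) (f : hom W X),
    cmp h (cmp g f) = cmp (cmp h g) f;
  cmp1m : forall X Y (f : hom X Y), cmp (idm Y) f = f;
  cmpm1 : forall X Y (f : hom X Y), cmp f (idm X) = f;
  cmpDl : forall X Y Z (g g' : hom Y Z) (f : hom X Y),
    cmp (g + g')%R f = (cmp g f + cmp g' f)%R;
  cmpDr : forall X Y Z (g : hom Y Z) (f f' : hom X Y),
    cmp g (f + f')%R = (cmp g f + cmp g f')%R;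
}.

Arguments hom {_} X Y.
Arguments idm {_} X.

Notation "g \oc f" := (cmp g f) (at level 40, left associativity).

Section Preadditive.
Context (C : preadditiveCat).
Implicit Types (X Y Z : C).

Definition zero_object Z : Prop :=
  (forall X (f : hom X Z), f = 0%R) /\ (forall X (f : hom Z X), f = 0%R).

Definition is_mono X Y (f : hom X Y) : Prop :=
  forall W (g h : hom W X), f \oc g = f \oc h -> g = h.

Definition is_epi X Y (f : hom X Y) : Prop :=
  forall W (g h : hom Y W), g \oc f = h \oc f -> g = h.

Definition is_iso X Y (f : hom X Y) : Prop :=
  exists g : hom Y X, g \oc f = idm X /\ f \oc g = idm Y.

Definition isomorphic X Y : Prop := exists f : hom X Y, is_iso f.

Definition is_kernel X Y (f : hom X Y) K (k : hom K X) : Prop :=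
  f \oc k = 0%R /\
  forall W (g : hom W X), f \oc g = 0%R -> exists! h : hom W K, k \oc h = g.

Definition is_cokernel X Y (f : hom X Y) Q (q : hom Y Q) : Prop :=
  q \oc f = 0%R /\
  forall W (g : hom Y W), g \oc f = 0%R -> exists! h : hom Q W, h \oc q = g.

Definition is_image X Y (f : hom X Y) I (i : hom I Y) : Prop :=
  exists Q (q : hom Y Q), is_cokernel f q /\ is_kernel q i.

Definition is_biproduct X Y P (i1 : hom X P) (i2 : hom Y P)
    (p1 : hom P X) (p2 : hom P Y) : Prop :=
  [/\ p1 \oc i1 = idm X, p2 \oc i2 = idm Y, p1 \oc i2 = 0%R, p2 \oc i1 = 0%R
    & (i1 \oc p1 + i2 \oc p2)%R = idm P].

Definition short_exact X Y Z (f : hom X Y) (g : hom Y Z) : Prop :=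
  is_kernel g f /\ is_cokernel f g.

Definition simple_object S : Prop :=
  ~ zero_object S /\
  forall X (i : hom X S), is_mono i -> zero_object X \/ is_iso i.

(* A chain [X 0 -> X 1 -> ... -> X n = M] of monomorphisms, starting at a zero
   object, whose successive cokernels are simple; [X k] is irrelevant for
   [n < k]. *)
Definition has_composition_series (M : C) : Prop :=
  exists (n : nat) (X : nat -> C) (i : forall k, hom (X k) (X k.+1)),
    [/\ zero_object (X 0%N), X n = M &
      forall k, (k < n)%N -> is_mono (i k) /\
        exists S (p : hom (X k.+1) S), is_cokernel (i k) p /\ simple_object S].

End Preadditive.

Record abelianCat := AbelianCat {
  preadditive_of_abelian :> preadditiveCat;
  abelian_zero : exists Z : preadditive_of_abelian, zero_object Z;
  abelian_biproduct : forall X Y : preadditive_of_abelian,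
    exists P (i1 : hom X P) (i2 : hom Y P) (p1 : hom P X) (p2 : hom P Y),
      is_biproduct i1 i2 p1 p2;
  abelian_kernel : forall (X Y : preadditive_of_abelian) (f : hom X Y),
    exists K (k : hom K X), is_kernel f k;
  abelian_cokernel : forall (X Y : preadditive_of_abelian) (f : hom X Y),
    exists Q (q : hom Y Q), is_cokernel f q;
  abelian_mono : forall (X Y : preadditive_of_abelian) (f : hom X Y),
    is_mono f -> exists Z (g : hom Y Z), is_kernel g f;
  abelian_epi : forall (X Y : preadditive_of_abelian) (f : hom X Y),
    is_epi f -> exists W (g : hom W X), is_cokernel g f;
}.

Definition length_category (A : abelianCat) : Prop :=
  forall M : A, has_composition_series M.

(* A full subcategory is given by its class of objects.  Skeletal smallness of
   the ambient category is implicit in its objects forming a type. *)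
Section Subcategories.
Context (A : abelianCat).
Implicit Types (D T U : set A).

Definition subcategory D : Prop :=
  D !=set0 /\ forall X Y, isomorphic X Y -> D X -> D Y.

Definition extension_closed D : Prop :=
  forall X Y Z (f : hom X Y) (g : hom Y Z),
    short_exact f g -> D X -> D Z -> D Y.

Definition quotient_closed D : Prop :=
  forall X Y (p : hom X Y), is_epi p -> D X -> D Y.

Definition kernel_closed D : Prop :=
  forall X Y (f : hom X Y), D X -> D Y ->
    forall K (k : hom K X), is_kernel f k -> D K.

Definition cokernel_closed D : Prop :=
  forall X Y (f : hom X Y), D X -> D Y ->
    forall Q (q : hom Y Q), is_cokernel f q -> D Q.

Definition image_closed D : Prop :=
  forall X Y (f : hom X Y), D X -> D Y ->
    forall I (i : hom I Y), is_image f i -> D I.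

Definition torsion_class : set (set A) :=
  [set T | [/\ subcategory T, extension_closed T & quotient_closed T]].

Definition wide : set (set A) :=
  [set D | [/\ subcategory D, extension_closed D, kernel_closed D
             & cokernel_closed D]].

Definition ice : set (set A) :=
  [set D | [/\ subcategory D, image_closed D, cokernel_closed D
             & extension_closed D]].

Definition right_perp D : set A :=
  [set M | forall X, D X -> forall f : hom X M, f = 0%R].

Definition heart U T : set A := T `&` right_perp U.

Definition tors_heart : set (set A) :=
  [set H | exists U T, [/\ torsion_class U, torsion_class T, U `<=` T
                         & H = heart U T]].

End Subcategories.

Arguments wide : clear implicits.
Arguments ice : clear implicits.
Arguments tors_heart : clear implicits.

Record tors (A : abelianCat) := Tors {
  tors_set :> set A;
  tors_setP : tors_set \in @torsion_class A;
}.

HB.instance Definition _ A := [isSub for @tors_set A].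
HB.instance Definition _ A := [Choice of tors A by <:].
HB.instance Definition _ A :=
  [SubChoice_isSubPOrder of tors A by <: with set_display].

Lemma tors_leE (A : abelianCat) (T U : tors A) :
  (T <= U) = (T `<=` U) :> Prop.
Proof. by rewrite -subsetEset. Qed.

Lemma torsion_class_bigcap (A : abelianCat) (X : set (tors A)) :
  \bigcap_(T in X) (T : set A) \in @torsion_class A.
Proof.
apply/mem_set; split.
- split=> [|Y Z YZ capY T XT].
    have [Z [_ outZ]] := abelian_zero A; exists Z => T _.
    have [[[Y TY] _] _ Tquo] := set_mem (tors_setP T).
    by apply: (Tquo Y Z 0%R) TY => W g h _; rewrite (outZ _ g) (outZ _ h).
  have [[_ Tiso] _ _] := set_mem (tors_setP T).
  by apply: Tiso YZ _; exact: capY.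
- move=> Y E Z f g fg capY capZ T XT.
  have [_ Text _] := set_mem (tors_setP T).
  by apply: (Text _ _ _ _ _ fg); [exact: capY|exact: capZ].
- move=> Y Z p epip capY T XT.
  have [_ _ Tquo] := set_mem (tors_setP T).
  by apply: Tquo epip _; exact: capY.
Qed.

Definition tors_inf (A : abelianCat) (X : set (tors A)) : tors A :=
  Tors (torsion_class_bigcap X).

Lemma tors_infP (A : abelianCat) (X : set (tors A)) : infimums X (tors_inf X).
Proof.
split=> [T XT|U lbU]; rewrite tors_leE; first exact: bigcap_inf.
by apply: sub_bigcap => T XT; rewrite -tors_leE; exact: lbU.
Qed.

HB.instance Definition _ A :=
  POrder_hasInfimums.Build set_display (tors A) (@tors_infP A).

(* Main.v *)
From mathcomp Require Import all_boot all_order all_algebra.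
From mathcomp Require Import boolp classical_sets functions.
Require Import Defs.

(** A torsion heart is filtered by its bricks, and a brick [B] lies in the heart
    of [[U, T]] if and only if the completely join-irreducible torsion class
    [T(B)] generated by [B] (for which [kappa (T(B))] is the left perpendicular
    of [B]) is a label of [[U, T]].  So sending a heart to the classes [T(B)] of
    its bricks [B] is an order embedding with image the set of label sets, and it
    remains to identify the hearts of wide and of ICE intervals.

    If [V] covers [U], a brick [B] in the heart of [[U, V]] is relatively simple:
    every nonzero map from [B] to an object of [U^perp] is a monomorphism with
    cokernel in [U^perp].  Peeling off such subobjects shows that hearts of ICE
    intervals are closed under cokernels, and those of wide intervals also under
    kernels.  Conversely, an ICE-closed subcategory [C] is the heart of the
    interval from [U], the left perpendicular of [C], to [T], the join of [U] and
    the torsion class generated by [C]; minimal quotients in [U^perp] of the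
    objects of [C] are relatively simple and produce covers of [U] whose join
    with [U] contains [C]. *)

Import Order.TTheory GRing.Theory.
Set Implicit Arguments.
Unset Strict Implicit.
Unset Printing Implicit Defensive.

Local Open Scope classical_set_scope.
Local Open Scope ring_scope.

(** * Preadditive categories: monomorphisms, kernels, opposite category *)

Section Preadditive.
Context (C : preadditiveCat).
Implicit Types (X Y Z W : C).

Lemma cmp0m X Y Z (f : hom X Y) : (0 : hom Y Z) \oc f = 0.
Proof. by apply: (addrI ((0 : hom Y Z) \oc f)); rewrite -cmpDl !addr0. Qed.

Lemma cmpm0 X Y Z (f : hom Y Z) : f \oc (0 : hom X Y) = 0.
Proof. by apply: (addrI (f \oc (0 : hom X Y))); rewrite -cmpDr !addr0. Qed.

Lemma cmpBl X Y Z (g g' : hom Y Z) (f : hom X Y) :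
  (g - g') \oc f = g \oc f - g' \oc f.
Proof. by apply: (addIr (g' \oc f)); rewrite -cmpDl !subrK. Qed.

Lemma cmpBr X Y Z (g : hom Y Z) (f f' : hom X Y) :
  g \oc (f - f') = g \oc f - g \oc f'.
Proof. by apply: (addIr (g \oc f')); rewrite -cmpDr !subrK. Qed.

Lemma monoP X Y (f : hom X Y) :
  is_mono f <-> forall W (g : hom W X), f \oc g = 0 -> g = 0.
Proof.
split=> [mf W g fg|mf W g h fgh]; first by apply: mf; rewrite cmpm0.
by apply/subr0_eq/mf; rewrite cmpBr fgh subrr.
Qed.

Lemma epiP X Y (f : hom X Y) :
  is_epi f <-> forall W (g : hom Y W), g \oc f = 0 -> g = 0.
Proof.
split=> [mf W g fg|mf W g h fgh]; first by apply: mf; rewrite cmp0m.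
by apply/subr0_eq/mf; rewrite cmpBl fgh subrr.
Qed.

Lemma mono_cmp X Y Z (f : hom X Y) (g : hom Y Z) :
  is_mono f -> is_mono g -> is_mono (g \oc f).
Proof. by move=> mf mg W u v; rewrite -!cmpA => /mg/mf. Qed.

Lemma epi_cmp X Y Z (f : hom X Y) (g : hom Y Z) :
  is_epi f -> is_epi g -> is_epi (g \oc f).
Proof. by move=> mf mg W u v; rewrite !cmpA => /mf/mg. Qed.

Lemma mono_cmp_r X Y Z (f : hom X Y) (g : hom Y Z) :
  is_mono (g \oc f) -> is_mono f.
Proof. by move=> m W u v uv; apply: m; rewrite -!cmpA uv. Qed.

Lemma epi_cmp_l X Y Z (f : hom X Y) (g : hom Y Z) :
  is_epi (g \oc f) -> is_epi g.
Proof. by move=> m W u v uv; apply: m; rewrite !cmpA uv. Qed.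

Lemma iso_mono X Y (f : hom X Y) : is_iso f -> is_mono f.
Proof.
by move=> [g [gf _]] W u v uv; rewrite -(cmp1m u) -(cmp1m v) -gf -!cmpA uv.
Qed.

Lemma iso_epi X Y (f : hom X Y) : is_iso f -> is_epi f.
Proof.
by move=> [g [_ fg]] W u v uv; rewrite -(cmpm1 u) -(cmpm1 v) -fg !cmpA uv.
Qed.

Lemma isomorphic_sym X Y : isomorphic X Y -> isomorphic Y X.
Proof. by move=> [f [g [gf fg]]]; exists g, f. Qed.

Lemma idm_mono X : is_mono (idm X).
Proof. by move=> W u v; rewrite !cmp1m. Qed.

Lemma idm_epi X : is_epi (idm X).
Proof. by move=> W u v; rewrite !cmpm1. Qed.

Lemma zero_objectP Z : zero_object Z <-> idm Z = 0.
Proof.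
split=> [[z _]|z]; first exact: z.
by split=> X f; [rewrite -(cmp1m f) z cmp0m | rewrite -(cmpm1 f) z cmpm0].
Qed.

Lemma mono_zero X Z (i : hom X Z) : is_mono i -> zero_object Z -> zero_object X.
Proof. by move=> /monoP mi [Z0 _]; apply/zero_objectP/mi; exact: Z0. Qed.

Lemma epi_zero X Z (p : hom Z X) : is_epi p -> zero_object Z -> zero_object X.
Proof. by move=> /epiP ep [_ Z0]; apply/zero_objectP/ep; exact: Z0. Qed.

Lemma epi_to_zero X Z (f : hom X Z) : zero_object Z -> is_epi f.
Proof. by move=> [_ Z0] W g h _; rewrite (Z0 _ g) (Z0 _ h). Qed.

Lemma kernel_mono X Y (f : hom X Y) K (k : hom K X) :
  is_kernel f k -> is_mono k.
Proof.
move=> [fk ku]; apply/monoP => W g kg; have [|h [_ hu]] := ku W 0.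
  by rewrite cmpm0.
by rewrite -(hu g kg) -(hu 0) // cmpm0.
Qed.

Lemma kernel_lift X Y (f : hom X Y) K (k : hom K X) W (g : hom W X) :
  is_kernel f k -> f \oc g = 0 -> exists h, k \oc h = g.
Proof. by move=> [_ ku] /ku [h [kh _]]; exists h. Qed.

Lemma kernel_intro X Y (f : hom X Y) K (k : hom K X) :
  is_mono k -> f \oc k = 0 ->
  (forall W (g : hom W X), f \oc g = 0 -> exists h, k \oc h = g) ->
  is_kernel f k.
Proof.
move=> mk fk kl; split=> // W g /kl[h kh]; exists h; split=> // h' kh'.
by apply: mk; rewrite kh.
Qed.

Lemma cokernel_epi X Y (f : hom X Y) Q (q : hom Y Q) :
  is_cokernel f q -> is_epi q.
Proof.
move=> [fk ku]; apply/epiP => W g kg; have [|h [_ hu]] := ku W 0.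
  by rewrite cmp0m.
by rewrite -(hu g kg) -(hu 0) // cmp0m.
Qed.

Lemma cokernel_desc X Y (f : hom X Y) Q (q : hom Y Q) W (g : hom Y W) :
  is_cokernel f q -> g \oc f = 0 -> exists h, h \oc q = g.
Proof. by move=> [_ ku] /ku [h [kh _]]; exists h. Qed.

Lemma kernel_mono_zero X Y (f : hom X Y) K (k : hom K X) :
  is_kernel f k -> zero_object K -> is_mono f.
Proof.
move=> kf K0; apply/monoP => W g /(kernel_lift kf)[h <-].
by case: K0 => K0 _; rewrite (K0 _ h) cmpm0.
Qed.

Lemma cokernel_epi_zero X Y (f : hom X Y) Q (q : hom Y Q) :
  is_cokernel f q -> zero_object Q -> is_epi f.
Proof.
move=> kf K0; apply/epiP => W g /(cokernel_desc kf)[h <-].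
by case: K0 => _ K0; rewrite (K0 _ h) cmp0m.
Qed.

Lemma ses_mono X Y Z (f : hom X Y) (g : hom Y Z) : short_exact f g -> is_mono f.
Proof. by case=> /kernel_mono. Qed.

Lemma ses_epi X Y Z (f : hom X Y) (g : hom Y Z) : short_exact f g -> is_epi g.
Proof. by case=> _ /cokernel_epi. Qed.

Lemma ses_cmp0 X Y Z (f : hom X Y) (g : hom Y Z) :
  short_exact f g -> g \oc f = 0.
Proof. by case=> -[]. Qed.

(** Kept transparent: kernels and monomorphisms of the opposite category are then convertible to
    cokernels and epimorphisms, so dual statements come by conversion. *)
Definition op_preadditive : preadditiveCat.
Proof.
refine (@PreadditiveCat C (fun X Y => hom Y X) (fun X => idm X)
  (fun X Y Z (g : hom Z Y) (f : hom Y X) => f \oc g) _ _ _ _ _) => *.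
- by rewrite cmpA.
- exact: cmpm1.
- exact: cmp1m.
- exact: cmpDr.
- exact: cmpDl.
Defined.

End Preadditive.

Section Opposite.
Context (A : abelianCat).

Definition op_cat : abelianCat.
Proof.
refine (@AbelianCat (op_preadditive A) _ _ _ _ _ _).
- by have [Z [Z1 Z2]] := abelian_zero A; exists Z.
- move=> X Y; have [P [i1 [i2 [p1 [p2 [E1 E2 E3 E4 E5]]]]]] :=
    abelian_biproduct X Y.
  by exists P, p1, p2, i1, i2.
- exact: (fun X Y => @abelian_cokernel A Y X).
- exact: (fun X Y => @abelian_kernel A Y X).
- exact: (fun X Y f => @abelian_epi A Y X f).
- exact: (fun X Y f => @abelian_mono A Y X f).
Defined.

End Opposite.

(** * Abelian categories: images, isomorphism theorems, pushouts *)

Section Abelian.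
Context (A : abelianCat).
Implicit Types (X Y Z W : A).

Lemma mono_kernel_coker X Y (f : hom X Y) Q (q : hom Y Q) :
  is_mono f -> is_cokernel f q -> is_kernel q f.
Proof.
move=> mf cq; have [Z [g kf]] := abelian_mono mf.
apply: kernel_intro => // [|W w qw]; first by case: cq.
have [t tq] := cokernel_desc cq (proj1 kf).
by apply: (kernel_lift kf); rewrite -tq -cmpA qw cmpm0.
Qed.

Lemma mono_ses X Y (f : hom X Y) : is_mono f ->
  exists Q (q : hom Y Q), short_exact f q.
Proof.
move=> mf; have [Q [q cq]] := abelian_cokernel f; exists Q, q.
by split=> //; exact: mono_kernel_coker.
Qed.

End Abelian.

Section AbelianDual.
Context (A : abelianCat).
Implicit Types (X Y Z W : A).

Lemma epi_coker_ker X Y (f : hom X Y) K (k : hom K X) :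
  is_epi f -> is_kernel f k -> is_cokernel k f.
Proof. exact: (@mono_kernel_coker (op_cat A) Y X f K k). Qed.

Lemma epi_ses X Y (f : hom X Y) : is_epi f ->
  exists K (k : hom K X), short_exact k f.
Proof.
move=> ef; have [K [k kk]] := abelian_kernel f; exists K, k.
by split=> //; exact: epi_coker_ker.
Qed.

Lemma kernel_ses X Y (f : hom X Y) K (k : hom K X) :
  is_epi f -> is_kernel f k -> short_exact k f.
Proof. by move=> ef kk; split=> //; exact: epi_coker_ker. Qed.

Lemma cokernel_ses X Y (f : hom X Y) Q (q : hom Y Q) :
  is_mono f -> is_cokernel f q -> short_exact f q.
Proof. by move=> ef kk; split=> //; exact: mono_kernel_coker. Qed.

Lemma mono_epi_iso X Y (f : hom X Y) : is_mono f -> is_epi f -> is_iso f.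
Proof.
move=> mf ef; have [Z [g kf]] := abelian_mono mf.
have g0 : g = 0 by apply/(proj1 (epiP f) ef)/(proj1 kf).
have [|h fh] := kernel_lift kf (_ : g \oc idm Y = 0); first by rewrite g0 cmp0m.
by exists h; split=> //; apply: mf; rewrite cmpA fh cmp1m cmpm1.
Qed.

(** If [h] kills [p], then [f] factors through the monomorphism [i \oc k], with [k] the kernel of
    [h]. This is a kernel of some [g], which kills [f] and hence [i]; so [i] factors through
    [i \oc k], [k] is split epi and [h = 0]. *)
Lemma image_factor X Y (f : hom X Y) I (i : hom I Y) : is_image f i ->
  is_mono i /\ exists p : hom X I, is_epi p /\ f = i \oc p.
Proof.
move=> [Q [q [cq ki]]]; have mi := kernel_mono ki; split=> //.
have [p ip] := kernel_lift ki (proj1 cq); exists p; split=> //.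
apply/epiP => Z h hp; have [K [k kh]] := abelian_kernel h.
have mk := kernel_mono kh; have [p' kp] := kernel_lift kh hp.
have [V [g kg]] := abelian_mono (mono_cmp mk mi).
have [|t tq] := cokernel_desc cq (_ : g \oc f = 0).
  by rewrite -ip -kp (cmpA i) (cmpA g) (proj1 kg) cmp0m.
have [|s ks] := kernel_lift kg (_ : g \oc i = 0).
  by rewrite -tq -cmpA; have [-> _] := ki; rewrite cmpm0.
have {}ks : k \oc s = idm I by apply: mi; rewrite cmpA ks cmpm1.
by rewrite -(cmpm1 h) -ks cmpA; have [-> _] := kh; rewrite cmp0m.
Qed.

Lemma epi_mono_factor X Y (f : hom X Y) :
  exists I (p : hom X I) (i : hom I Y), [/\ is_epi p, is_mono i & f = i \oc p].
Proof.
have [Q [q cq]] := abelian_cokernel f; have [I [i ki]] := abelian_kernel q.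
have [mi [p [ep fE]]] : is_mono i /\ exists p, is_epi p /\ f = i \oc p.
  by apply: image_factor; exists Q, q.
by exists I, p, i.
Qed.

Lemma epi_mono_image X Y I (p : hom X I) (i : hom I Y) :
  is_epi p -> is_mono i -> is_image (i \oc p) i.
Proof.
move=> ep mi; have [Q [q [ki ci]]] := mono_ses mi; exists Q, q; split=> //.
split=> [|W g gip]; first by rewrite cmpA; have [-> _] := ki; rewrite cmp0m.
by apply: (proj2 ci); apply: (proj1 (epiP p) ep); rewrite -cmpA.
Qed.

(* With [epi_cmp_l] this reduces surjectivity and lifting arguments to
   computations with generalized elements, defined up to an epimorphism. *)
Lemma epi_lift X Y W (p : hom X Y) (w : hom W Y) : is_epi p ->
  exists W' (e : hom W' W) (x : hom W' X), is_epi e /\ p \oc x = w \oc e.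
Proof.
move=> ep.
have [S [i1 [i2 [p1 [p2 [E1 E2 E3 E4 E5]]]]]] := abelian_biproduct X W.
pose d := p \oc p1 - w \oc p2; have [P [k kd]] := abelian_kernel d.
have di1 : d \oc i1 = p by rewrite cmpBl -!cmpA E1 E4 cmpm1 cmpm0 subr0.
have ed : is_epi d by apply: (@epi_cmp_l _ _ _ _ i1); rewrite di1.
exists P, (p2 \oc k), (p1 \oc k); split; last first.
  by apply/subr0_eq; rewrite !cmpA -cmpBl; exact: proj1 kd.
apply/epiP => Z h hk.
have [|t td] :=
  cokernel_desc (epi_coker_ker ed kd) (_ : (h \oc p2) \oc k = 0).
  by rewrite -cmpA.
have t0 : t = 0.
  by apply: (proj1 (epiP p) ep); rewrite -di1 cmpA td -cmpA E4 cmpm0.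
by rewrite -(cmpm1 h) -E2 cmpA -td t0 !cmp0m.
Qed.

(** The local lift [h] kills the kernel of [e], since [k] is mono, and so descends along [e]. *)
Lemma kernel_intro_local X Y (f : hom X Y) K (k : hom K X) :
  is_mono k -> f \oc k = 0 ->
  (forall W (g : hom W X), f \oc g = 0 -> exists W' (e : hom W' W) h,
    is_epi e /\ k \oc h = g \oc e) ->
  is_kernel f k.
Proof.
move=> mk fk kl; apply: kernel_intro => // W g /kl[W' [e [h [ee kh]]]].
have [N [n ne]] := epi_ses ee.
have [|h' h'e] := cokernel_desc (proj2 ne) (_ : h \oc n = 0).
  apply: (proj1 (monoP k) mk).
  by rewrite cmpA kh -cmpA (ses_cmp0 ne) cmpm0.
by exists h'; apply: ee; rewrite -cmpA h'e.
Qed.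

(** Used to form preimages: if [r] is the quotient by a subobject [K''] of [Y], then [K'] is its
    preimage in [X], an extension of [K''] by [K]. *)
Lemma ker_comp_ses X Y Z (p : hom X Y) (r : hom Y Z)
    K (k : hom K X) K' (k' : hom K' X) K'' (k'' : hom K'' Y) :
  is_epi p -> is_kernel p k -> is_kernel (r \oc p) k' -> is_kernel r k'' ->
  exists (a : hom K K') (b : hom K' K''),
    [/\ short_exact a b, k' \oc a = k & k'' \oc b = p \oc k'].
Proof.
move=> ep kk kk' kk''.
have [|a aE] := kernel_lift kk' (_ : (r \oc p) \oc k = 0).
  by rewrite -cmpA; have [-> _] := kk; rewrite cmpm0.
have [|b bE] := kernel_lift kk'' (_ : r \oc (p \oc k') = 0).
  by rewrite cmpA; case: kk'.
have mk' := kernel_mono kk'; have mk'' := kernel_mono kk''.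
exists a, b; split=> //; apply: kernel_ses.
  have [W' [e [x [ee px]]]] := epi_lift k'' ep.
  have [|y k'y] := kernel_lift kk' (_ : (r \oc p) \oc x = 0).
    by rewrite -cmpA px cmpA; have [-> _] := kk''; rewrite cmp0m.
  apply: (@epi_cmp_l _ _ _ _ y).
  suff -> : b \oc y = e by [].
  by apply: mk''; rewrite cmpA bE -cmpA k'y.
apply: kernel_intro.
- by apply: (@mono_cmp_r _ _ _ _ _ k'); rewrite aE; exact: kernel_mono kk.
- by apply: mk''; rewrite cmpA bE -cmpA aE cmpm0; case: kk.
move=> W g bg; have [|h kh] := kernel_lift kk (_ : p \oc (k' \oc g) = 0).
  by rewrite cmpA -bE -cmpA bg cmpm0.
by exists h; apply: mk'; rewrite cmpA aE.
Qed.

End AbelianDual.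

Section AbelianOps.
Context (A : abelianCat).
Implicit Types (X Y Z W : A).

(** For subobjects [X] of [Y] of [Z] this is the third isomorphism theorem; it is dual to
    [ker_comp_ses]. *)
Lemma coker_comp_ses X Y Z (f : hom X Y) (g : hom Y Z)
    Q (q : hom Z Q) Q' (q' : hom Z Q') Q'' (q'' : hom Y Q'') :
  is_mono g -> is_cokernel g q -> is_cokernel (g \oc f) q' ->
  is_cokernel f q'' ->
  exists (a : hom Q' Q) (b : hom Q'' Q'),
    [/\ short_exact b a, a \oc q' = q & b \oc q'' = q' \oc g].
Proof.
move=> mg cq cq' cq''; have [a [b [[s1 s2] E1 E2]]] :=
  @ker_comp_ses (op_cat A) Z Y X g f Q q Q' q' Q'' q'' mg cq cq' cq''.
by exists a, b; split.
Qed.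

Lemma pushout_ses K M I Y (k : hom K M) (p : hom M I) (g : hom K Y) :
  short_exact k p -> exists E (y : hom Y E) (m : hom M E) (q : hom E I),
    [/\ short_exact y q, m \oc k = y \oc g, q \oc m = p &
        forall V (u : hom Y V) (v : hom M V), v \oc k = u \oc g ->
          exists t : hom E V, t \oc y = u /\ t \oc m = v].
Proof.
move=> [kk ck].
have [S [i1 [i2 [p1 [p2 [E1 E2 E3 E4 E5]]]]]] := abelian_biproduct Y M.
(* The pushout is the cokernel of the map with components [- g] and [k] into the biproduct. *)
pose d := i2 \oc k - i1 \oc g; have [E [c cd]] := abelian_cokernel d.
have ec := cokernel_epi cd; have mk := kernel_mono kk.
have p2d : p2 \oc d = k by rewrite cmpBr !cmpA E2 E4 cmp1m cmp0m subr0.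
have p1d : p1 \oc d = - g.
  by rewrite cmpBr !cmpA E3 E1 cmp1m cmp0m sub0r.
have md : is_mono d by apply: (@mono_cmp_r _ _ _ _ _ p2); rewrite p2d.
have [|q qc] := cokernel_desc cd (_ : (p \oc p2) \oc d = 0).
  by rewrite -cmpA p2d; case: kk.
have sq : (c \oc i2) \oc k = (c \oc i1) \oc g.
  by apply/subr0_eq; rewrite -!cmpA -cmpBr; case: cd.
have up V (u : hom Y V) (v : hom M V) : v \oc k = u \oc g ->
    exists t : hom E V, t \oc (c \oc i1) = u /\ t \oc (c \oc i2) = v.
  move=> vu.
  have [|t tc] := cokernel_desc cd (_ : (u \oc p1 + v \oc p2) \oc d = 0).
    apply/eqP; rewrite cmpDl -!cmpA p1d p2d -[- g]sub0r cmpBr cmpm0 sub0r vu.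
    by rewrite addrC subrr.
  exists t; rewrite !cmpA tc !cmpDl -!cmpA E1 E2 E3 E4 !cmpm0 !cmpm1.
  by rewrite addr0 add0r.
have qi1 : q \oc (c \oc i1) = 0 by rewrite cmpA qc -cmpA E4 cmpm0.
have qi2 : q \oc (c \oc i2) = p by rewrite cmpA qc -cmpA E2 cmpm1.
exists E, (c \oc i1), (c \oc i2), q; split=> //.
apply: cokernel_ses.
  apply/monoP => W w; rewrite -cmpA => cw.
  have [h dh] := kernel_lift (mono_kernel_coker md cd) cw.
  have h0 : h = 0.
    apply: (proj1 (monoP k) mk).
    by rewrite -p2d -cmpA dh cmpA E4 cmp0m.
  by rewrite -(cmp1m w) -E1 -cmpA -dh h0 !cmpm0.
split=> // W w wi.
have [|h hp] := cokernel_desc ck (_ : (w \oc (c \oc i2)) \oc k = 0).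
  by rewrite -cmpA sq cmpA wi cmp0m.
have hq : h \oc q = w.
  apply: ec; rewrite -[RHS]cmpm1 -E5 cmpDr -!cmpA qc !cmpA hp.
  by move: wi; rewrite !cmpA => ->; rewrite cmp0m add0r.
exists h; split=> // h' h'q; apply: (cokernel_epi ck).
by rewrite -qi2 !cmpA hq h'q.
Qed.

End AbelianOps.

(** * Composition length on short exact sequences *)

Section Length.
Context (A : abelianCat).
Implicit Types (X Y Z M : A).

Fixpoint composition_length (n : nat) M : Prop :=
  if n is m.+1 then exists M' S (i : hom M' M) (p : hom M S),
    [/\ short_exact i p, simple_object S & composition_length m M']
  else zero_object M.

Lemma simple_epi X S (f : hom X S) : simple_object S -> f <> 0 -> is_epi f.
Proof.
move=> [_ sS] f0; have [I [p [i [ep mi fE]]]] := epi_mono_factor f.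
have [[I0 _]|ii] := sS _ _ mi; first by case: f0; rewrite fE (I0 _ p) cmpm0.
by rewrite fE; apply: epi_cmp => //; exact: iso_epi.
Qed.

(** Induction on [n]: the top simple factor [S] of [M] is passed to [Z] if [X] maps to zero in [S],
    and to [X] otherwise. *)
Lemma composition_length_ses n X M Z (i : hom X M) (q : hom M Z) :
  short_exact i q -> composition_length n M ->
  exists a b,
    [/\ (a + b = n)%N, composition_length a X & composition_length b Z].
Proof.
elim: n => [|n IHn] in X M Z i q *.
  move=> iq M0; exists 0%N, 0%N; split=> //=.
    exact: mono_zero (ses_mono iq) M0.
  exact: epi_zero (ses_epi iq) M0.
move=> iq [M' [S [m [s [ms sS nM']]]]].
have mi := ses_mono iq; have eq := ses_epi iq.
have mm := ses_mono ms; have [km cs] := ms; have [ki cq] := iq.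
have [si0|si0] := pselect (s \oc i = 0).
  (* Here [X] lies in [M'], and [Z] is an extension of [S] by [M'/X]. *)
  have [x mx] := kernel_lift km si0.
  have mx' : is_mono x by apply: (@mono_cmp_r _ _ _ _ _ m); rewrite mx.
  have [Z' [z xz]] := mono_ses mx'; rewrite -mx in cq.
  have [a [b [ba _ _]]] := coker_comp_ses mm cs cq (proj2 xz).
  have [c [e [<- cX eZ']]] := IHn _ _ _ _ _ xz nM'.
  by exists c, e.+1; rewrite addnS; split=> //; exists Z', S, b, a.
(* Here [S] is a quotient of [X], and [Z] is the quotient of [M'] by [K], the intersection of [X]
   and [M']. *)
have es := simple_epi sS si0; have [K [k ksi]] := epi_ses es.
have [|j mj] := kernel_lift km (_ : s \oc (i \oc k) = 0).
  by rewrite cmpA (ses_cmp0 ksi).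
have jq : short_exact j (q \oc m).
  apply: kernel_ses.
    apply/epiP => V h; rewrite cmpA => hqm.
    have [t ts] := cokernel_desc cs hqm.
    have t0 : t = 0.
      apply: (proj1 (epiP _) es).
      by rewrite cmpA ts -cmpA (proj1 ki) cmpm0.
    by apply: (proj1 (epiP _) eq); rewrite -ts t0 cmp0m.
  apply: kernel_intro.
  - apply: (@mono_cmp_r _ _ _ _ _ m); rewrite mj.
    by apply: mono_cmp mi; exact: ses_mono ksi.
  - by rewrite -cmpA mj cmpA (proj1 ki) cmp0m.
  move=> W g; rewrite -cmpA => qmg; have [x ix] := kernel_lift ki qmg.
  have [|y ky] := kernel_lift (proj1 ksi) (_ : (s \oc i) \oc x = 0).
    by rewrite -cmpA ix cmpA (proj1 km) cmp0m.
  by exists y; apply: mm; rewrite cmpA mj -cmpA ky.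
have [a [b [<- aK bZ]]] := IHn _ _ _ _ _ jq nM'.
by exists a.+1, b; rewrite addSn; split=> //; exists K, S, k, (s \oc i).
Qed.

Lemma composition_series_length M : has_composition_series M ->
  exists n, composition_length n M.
Proof.
move=> [n [X [i [X0 <- ci]]]]; exists n.
have: (n <= n)%N by []. move: {-2}n => k; elim: k => [|k IHk] // kn.
have [mi [S [p [cp sS]]]] := ci _ kn.
exists (X k), S, (i k), p; split=> //; last by apply: IHk; exact: ltnW.
exact: cokernel_ses.
Qed.

(** With the least length, splitting a shortest series of the middle term of a short exact sequence
    bounds both ends, which gives [objlen_ses]. The default [0] occurs only for objects without a
    composition length. *)
Definition objlen M : nat :=
  xget 0%N [set n | composition_length n M /\
                    forall m, composition_length m M -> (n <= m)%N].

Context (hA : length_category A).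

Lemma objlenP M : composition_length (objlen M) M /\
  forall m, composition_length m M -> (objlen M <= m)%N.
Proof.
have [n nM] := composition_series_length (hA M).
have ex : exists n, `[< composition_length n M >] by exists n; exact/asboolP.
case: (ex_minnP ex) => m /asboolP mM minm.
rewrite /objlen; set S := [set n | _].
apply: (@xgetPex nat 0%N S); exists m.
by split=> // m' /asboolP/minm.
Qed.

Lemma objlen_ses X Y Z (f : hom X Y) (g : hom Y Z) : short_exact f g ->
  (objlen X + objlen Z <= objlen Y)%N.
Proof.
move=> fg; have [/(composition_length_ses fg)[a [b [<- aX bZ]]] _] := objlenP Y.
by apply: leq_add; [apply: (proj2 (objlenP X)) | apply: (proj2 (objlenP Z))].
Qed.

Lemma objlen_gt0 X : ~ zero_object X -> (0 < objlen X)%N.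
Proof.
move=> X0; rewrite lt0n; apply/eqP => lX.
by have := objlenP X; rewrite lX => -[].
Qed.

Lemma objlen_epi X Y (f : hom X Y) : is_epi f -> (objlen Y <= objlen X)%N.
Proof.
move=> /epi_ses[Q [q /objlen_ses]]; apply: leq_trans; exact: leq_addl.
Qed.

Lemma objlen_ses_ltl X Y Z (f : hom X Y) (g : hom Y Z) : short_exact f g ->
  ~ zero_object Z -> (objlen X < objlen Y)%N.
Proof.
move=> /objlen_ses fg /objlen_gt0 Z0; apply: leq_trans fg.
by rewrite -{1}[objlen X]addn0 ltn_add2l.
Qed.

Lemma objlen_ses_ltr X Y Z (f : hom X Y) (g : hom Y Z) : short_exact f g ->
  ~ zero_object X -> (objlen Z < objlen Y)%N.
Proof.
move=> /objlen_ses fg /objlen_gt0 Z0; apply: leq_trans fg.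
by rewrite -{1}[objlen Z]add0n ltn_add2r.
Qed.

Lemma objlen_mono_iso X Y (f : hom X Y) : is_mono f ->
  (objlen Y <= objlen X)%N -> is_iso f.
Proof.
move=> mf; have [Q [q fq]] := mono_ses mf; rewrite leqNgt => lt.
apply: mono_epi_iso => //; apply: (cokernel_epi_zero (proj2 fq)).
by apply: contrapT => /(objlen_ses_ltl fq); exact/negP.
Qed.

Lemma objlen_epi_iso X Y (f : hom X Y) : is_epi f ->
  (objlen X <= objlen Y)%N -> is_iso f.
Proof.
move=> ef; have [Q [q fq]] := epi_ses ef; rewrite leqNgt => lt.
apply: mono_epi_iso => //; apply: (kernel_mono_zero (proj1 fq)).
by apply: contrapT => /(objlen_ses_ltr fq); exact/negP.
Qed.

End Length.

(** * Torsion pairs, bricks and filtrations of hearts *)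

Section TorsionPairs.
Context (A : abelianCat).
Implicit Types (B X Y Z M : A) (D T U : set A).

Definition left_perp D : set A :=
  [set M | forall X, D X -> forall f : hom M X, f = 0].

Lemma left_perp_torsion D : torsion_class (left_perp D).
Proof.
split.
- split=> [|X Y [f [g [gf fg]]] PX Z DZ h].
    have [Z [_ Z0]] := abelian_zero A; exists Z.
    by move=> X _ f; exact: Z0.
  by rewrite -(cmpm1 h) -fg cmpA (PX _ DZ (h \oc f)) cmp0m.
- move=> X Y Z f g fg PX PZ V DV h.
  have [t <-] := cokernel_desc (proj2 fg) (PX _ DV (h \oc f)).
  by rewrite (PZ _ DV t) cmp0m.
- move=> X Y p ep PX V DV h; apply: (proj1 (epiP p) ep).
  exact: PX.
Qed.

Lemma right_perp_sub D X Y (i : hom X Y) :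
  is_mono i -> right_perp D Y -> right_perp D X.
Proof.
by move=> mi DY V DV h; apply: (proj1 (monoP i) mi); exact: DY.
Qed.

Lemma right_perp_ext D : extension_closed (right_perp D).
Proof.
move=> X Y Z f g fg PX PZ V DV h.
have [t <-] := kernel_lift (proj1 fg) (PZ _ DV (g \oc h)).
by rewrite (PX _ DV t) cmpm0.
Qed.

Lemma torsion_quot T X Y (p : hom X Y) :
  torsion_class T -> is_epi p -> T X -> T Y.
Proof. by case=> _ _; apply. Qed.

Lemma torsion_ext T X Y Z (f : hom X Y) (g : hom Y Z) :
  torsion_class T -> short_exact f g -> T X -> T Z -> T Y.
Proof. by case=> _ + _; apply. Qed.

Lemma torsion_zero T Z : torsion_class T -> zero_object Z -> T Z.
Proof.
move=> tT Z0; have [[[X TX] _] _ _] := tT.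
by apply: (torsion_quot (p := 0 : hom X Z)) TX => //; exact: epi_to_zero.
Qed.

Lemma zero_right_perp T X : T X -> right_perp T X -> zero_object X.
Proof. by move=> TX FX; apply/zero_objectP; exact: FX. Qed.

Lemma heart_image U T X Y I (p : hom X I) (i : hom I Y) : torsion_class T ->
  is_epi p -> is_mono i -> T X -> right_perp U Y -> heart U T I.
Proof.
move=> tT ep mi TX FY; split; first exact: torsion_quot ep TX.
exact: right_perp_sub mi FY.
Qed.

Lemma heart_ext U T : torsion_class T -> extension_closed (heart U T).
Proof.
move=> tT X Y Z f g fg [TX FX] [TZ FZ].
by split; [exact: torsion_ext fg TX TZ | exact: right_perp_ext fg FX FZ].
Qed.

Context (hA : length_category A).

(** Take [N] in [T] with [Q] of least length. A nonzero map from [T] to [Q] has an image [I] in [T],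
    and the preimage of [I] in [M] is again in [T], with a shorter quotient. *)
Lemma torsion_pair T M : torsion_class T ->
  exists N Q (i : hom N M) (q : hom M Q),
    [/\ short_exact i q, T N & right_perp T Q].
Proof.
move=> tT.
pose P n := `[< exists N Q (i : hom N M) (q : hom M Q),
  [/\ short_exact i q, T N & objlen Q = n] >].
have exP : exists n, P n.
  exists (objlen M); apply/asboolP.
  have [N [i iq]] := epi_ses (@idm_epi _ M).
  exists N, M, i, (idm M); split=> //; apply: torsion_zero tT _.
  apply/zero_objectP/(ses_mono iq); rewrite cmpm0 cmpm1.
  by rewrite -[LHS](cmp1m i) (ses_cmp0 iq).
case: (ex_minnP exP) => n /asboolP[N [Q [i [q [iq TN Qn]]]]] minn.
exists N, Q, i, q; split=> // X TX g; apply: contrapT => g0.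
have [I [p [j [ep mj gE]]]] := epi_mono_factor g.
have [R [r jr]] := mono_ses mj.
have erq : is_epi (r \oc q).
  by apply: epi_cmp; [exact: ses_epi iq | exact: ses_epi jr].
have [K [k kr]] := epi_ses erq.
have [a [b [ab _ _]]] :=
  ker_comp_ses (ses_epi iq) (proj1 iq) (proj1 kr) (proj1 jr).
have TI : T I by exact: torsion_quot ep TX.
have TK : T K by exact: torsion_ext ab TN TI.
have I0 : ~ zero_object I.
  by move=> [I0 _]; apply: g0; rewrite gE (I0 _ p) cmpm0.
have := objlen_ses_ltr hA jr I0; rewrite ltnNge Qn => /negP; apply.
by apply: minn; apply/asboolP; exists K, R, k, (r \oc q).
Qed.

Definition brick B : Prop := ~ zero_object B /\
  forall f : hom B B, f = 0 \/ is_iso f.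

Lemma right_perpS D D' : D `<=` D' -> right_perp D' `<=` right_perp D.
Proof. by move=> DD' X FX Y /DD'; exact: FX. Qed.

(* If the kernel [K] of a quotient [M -> N] in the heart has a nonzero torsion
   part [tK], then [tK -> M -> M / tK] is the desired sequence.  Otherwise all
   such [K] are torsion-free, and for a nonzero non-isomorphism [f : M -> M]
   with image of minimal length, [f] and [f \oc f] have the same image and
   kernel; so [ker f] is a direct summand of the torsion object [M] and
   vanishes, a contradiction. *)
Lemma heart_brick_or_ses U T M : torsion_class T -> U `<=` T ->
  heart U T M -> ~ zero_object M -> brick M \/
  exists X Z (f : hom X M) (g : hom M Z), [/\ short_exact f g,
    heart U T X, heart U T Z, ~ zero_object X & ~ zero_object Z].
Proof.
move=> tT UT [TM FM] M0; apply: contrapT => /not_orP[nb ns].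
have kerF N (q : hom M N) K (k : hom K M) : short_exact k q -> heart U T N ->
    ~ zero_object N -> right_perp T K.
  move=> kq [TN FN] N0.
  have [K1 [K2 [i [p [ip TK1 FK2]]]]] := torsion_pair K tT.
  have mki := mono_cmp (ses_mono ip) (ses_mono kq).
  have [R [r kir]] := mono_ses mki.
  have [a [b [ba aE _]]] :=
    coker_comp_ses (ses_mono kq) (proj2 kq) (proj2 kir) (proj2 ip).
  have hR : heart U T R.
    split; first exact: torsion_quot (ses_epi kir) TM.
    by apply: right_perp_ext ba _ FN; exact: right_perpS FK2.
  have K10 : zero_object K1.
    apply: contrapT => K10; apply: ns.
    exists K1, R, (k \oc i), r; split=> //.
      by split=> //; exact: right_perp_sub mki FM.
    by move=> /(epi_zero (ses_epi ba)).
  apply: right_perp_sub FK2; apply: kernel_mono_zero K10; exact: proj1 ip.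
pose P n := `[< exists f : hom M M, exists I (p : hom M I) (i : hom I M),
  [/\ f <> 0 /\ ~ is_iso f, f = i \oc p, is_epi p, is_mono i & objlen I = n] >].
have exP : exists n, P n.
  have [f [f0 fi]] : exists f : hom M M, f <> 0 /\ ~ is_iso f.
    apply: contrapT => nf; apply: nb; split=> // f.
    by apply: contrapT => /not_orP[f0 fi]; apply: nf; exists f.
  have [I [p [i [ep mi fE]]]] := epi_mono_factor f.
  by exists (objlen I); apply/asboolP; exists f, I, p, i.
case: (ex_minnP exP) => n /asboolP[f [I [p [i [[f0 fi] fE ep mi In]]]]] minn.
have [hTI hFI] := heart_image tT ep mi TM FM.
have I0 : ~ zero_object I.
  by move=> [I0 _]; apply: f0; rewrite fE (I0 _ p) cmpm0.
have [K [k kp]] := epi_ses ep.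
have FK := kerF _ _ _ _ kp (conj hTI hFI) I0.
have kill (h : hom M M) : f \oc h = 0 -> h = 0.
  move=> fh; have [|t <-] := kernel_lift (proj1 kp) (_ : p \oc h = 0).
    by apply: (proj1 (monoP i) mi); rewrite cmpA -fE.
  by rewrite (FK _ TM t) cmpm0.
have [J [q [j [eq mj piE]]]] := epi_mono_factor (p \oc i).
have ff : f \oc f = (i \oc j) \oc (q \oc p).
  by rewrite fE -!cmpA (cmpA p) piE -!cmpA.
have nJ : (n <= objlen J)%N.
  apply: minn; apply/asboolP.
  exists (f \oc f), J, (q \oc p), (i \oc j); split=> //.
  - split; first by move=> /kill.
    move=> ffi; apply: fi; apply: mono_epi_iso.
      by apply: mono_cmp_r; exact: iso_mono ffi.
    by apply: epi_cmp_l; exact: iso_epi ffi.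
  - exact: epi_cmp.
  - exact: mono_cmp.
have ij : is_iso j by apply: (objlen_mono_iso hA) => //; rewrite In.
have iq : is_iso q.
  apply: (objlen_epi_iso hA) => //; apply: leq_trans nJ; rewrite -In //.
have [t [tpi pit]] : is_iso (p \oc i).
  rewrite piE; apply: mono_epi_iso.
    by apply: mono_cmp; exact: iso_mono.
  by apply: epi_cmp; exact: iso_epi.
have e1 : i \oc t \oc p = idm M.
  apply/esym/subr0_eq/kill; rewrite cmpBr cmpm1 fE -!cmpA (cmpA p i).
  by rewrite (cmpA _ t p) pit cmp1m subrr.
apply: fi; rewrite fE; apply: mono_epi_iso.
  apply: mono_cmp => //; apply: (@mono_cmp_r _ _ _ _ _ (i \oc t)).
  rewrite e1; exact: idm_mono.
apply: epi_cmp => //; apply: (@epi_cmp_l _ _ _ _ (t \oc p)).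
rewrite cmpA e1; exact: idm_epi.
Qed.

(** Induction on length: a nonzero non-brick is an extension of shorter objects of the heart. *)
Lemma heart_filtration U T D : torsion_class T -> U `<=` T ->
  extension_closed D -> (forall Z, zero_object Z -> D Z) ->
  (forall B, heart U T B -> brick B -> D B) -> heart U T `<=` D.
Proof.
move=> tT UT eD zD bD M; have [n] := ubnP (objlen M).
elim: n => // n IHn in M *; rewrite ltnS => Mn hM.
have [M0|M0] := pselect (zero_object M); first exact: zD.
have [bM|[X [Z [f [g [fg hX hZ X0 Z0]]]]]] := heart_brick_or_ses tT UT hM M0.
  exact: bD.
apply: (eD _ _ _ _ _ fg); apply: IHn => //; apply: leq_trans Mn.
  exact: objlen_ses_ltl fg Z0.
exact: objlen_ses_ltr fg X0.
Qed.

(** A nonzero non-isomorphic endomorphism has a shorter image, which stays in the heart. *)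
Lemma heart_exists_brick U T M : torsion_class T -> heart U T M ->
  ~ zero_object M -> exists2 B, heart U T B & brick B.
Proof.
move=> tT; have [n] := ubnP (objlen M).
elim: n => // n IHn in M *; rewrite ltnS => Mn hM M0.
have [bM|nb] := pselect (brick M); first by exists M.
have [f [f0 fi]] : exists f : hom M M, f <> 0 /\ ~ is_iso f.
  apply: contrapT => nf; apply: nb; split=> // f.
  by apply: contrapT => /not_orP[f0 fi]; apply: nf; exists f.
have [I [p [i [ep mi fE]]]] := epi_mono_factor f.
apply: (IHn I).
- apply: leq_trans Mn; rewrite ltnNge; apply/negP => MI; apply: fi.
  have ii := objlen_mono_iso hA mi MI; have ip := objlen_epi_iso hA ep MI.
  rewrite fE; apply: mono_epi_iso.
    by apply: mono_cmp => //; exact: iso_mono.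
  by apply: epi_cmp => //; exact: iso_epi.
- by case: hM => TM FM; exact: heart_image ep mi TM FM.
by move=> [I0 _]; apply: f0; rewrite fE (I0 _ p) cmpm0.
Qed.

End TorsionPairs.

(** * Bricks and completely join-irreducible torsion classes *)

Section BrickLabels.
Context (A : abelianCat).
Implicit Types (B X Y Z M : A) (D : set A) (T U V : tors A).

Lemma torsP T : torsion_class (tors_set T).
Proof. exact: set_mem (tors_setP T). Qed.

Definition tors_gen B : tors A := tors_inf [set T | tors_set T B].

Definition tors_perp D : tors A := Tors (mem_set (left_perp_torsion D)).

Lemma tors_leP T U : (T <= U)%O <-> tors_set T `<=` tors_set U.
Proof. by rewrite tors_leE. Qed.

Lemma tors_gen_le B T : (tors_gen B <= T)%O <-> tors_set T B.
Proof.
split=> [/tors_leP|TB]; first by apply=> V.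
by have [lb _] := tors_infP [set T | tors_set T B]; exact: lb.
Qed.

Lemma tors_gen_mem B : tors_set (tors_gen B) B.
Proof. exact/tors_gen_le. Qed.

Lemma le_tors_perp T D :
  (T <= tors_perp D)%O <-> forall X, D X -> right_perp (tors_set T) X.
Proof.
split=> [/tors_leP TD X DX M TM f|TD]; first exact: (TD _ TM).
by apply/tors_leP => M TM X DX f; exact: TD.
Qed.

Lemma tors_meetP T U X :
  tors_set (T `&` U)%O X <-> tors_set T X /\ tors_set U X.
Proof.
split=> [|[TX UX]].
  by have /tors_leP h1 := leIl T U; have /tors_leP h2 := leIr U T; split; auto.
have : (tors_inf [set T; U] <= T `&` U)%O.
  have [lb _] := tors_infP [set T; U].
  by rewrite lexI !lb //=; [right|left].
by move/tors_leP; apply=> _ /= [] ->.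
Qed.

Lemma bigjoin_le (P : set (tors A)) T :
  (bigjoin P <= T)%O <-> forall V, P V -> (V <= T)%O.
Proof.
have [ub lub] := bigjoinP P; split=> [PT V /ub VP|]; last exact: lub.
exact: le_trans PT.
Qed.

Lemma le_bigjoin (P : set (tors A)) V : P V -> (V <= bigjoin P)%O.
Proof. by have [ub _] := bigjoinP P; exact: ub. Qed.

(* Otherwise the whole join would be contained in the torsion class
   [tors_perp [set X]], to which [X] does not belong. *)
Lemma join_hom U (P : set (tors A)) X : tors_set (U `|` bigjoin P)%O X ->
  ~ zero_object X -> right_perp (tors_set U) X ->
  exists V, P V /\ ~ right_perp (tors_set V) X.
Proof.
move=> joinX X0 UX; apply: contrapT => nV; apply: X0.
have : (U `|` bigjoin P <= tors_perp [set X])%O.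
  rewrite leUx; apply/andP; split; first by apply/le_tors_perp => _ ->.
  apply/bigjoin_le => V PV; apply/le_tors_perp => _ ->.
  by apply: contrapT => VX; apply: nV; exists V.
by move=> /tors_leP/(_ X joinX) XX; apply/zero_objectP/XX.
Qed.

Lemma tors_gen_hom B X : tors_set (tors_gen B) X -> ~ zero_object X ->
  exists f : hom B X, f <> 0.
Proof.
move=> BX X0; apply: contrapT => nf; apply: X0.
have /tors_leP/(_ _ BX) XX : (tors_gen B <= tors_perp [set X])%O.
  apply/tors_gen_le => _ -> f.
  by apply: contrapT => f0; apply: nf; exists f.
by apply/zero_objectP/XX.
Qed.

Lemma hom_neq0_image X Y (f : hom X Y) : f <> 0 ->
  exists I (p : hom X I) (i : hom I Y),
    [/\ is_epi p, is_mono i, f = i \oc p & ~ zero_object I].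
Proof.
move=> f0; have [I [p [i [ep mi fE]]]] := epi_mono_factor f.
by exists I, p, i; split=> // -[I0 _]; apply: f0; rewrite fE (I0 _ p) cmpm0.
Qed.

Lemma brick_retract B X (f : hom B X) (g : hom X B) : brick B ->
  g \oc f <> 0 -> exists h : hom X B, h \oc f = idm B.
Proof.
move=> [_ bB] gf; have [//|[h [hE _]]] := bB (g \oc f).
by exists (h \oc g); rewrite -cmpA.
Qed.

(** The image [I] of a nonzero map from [U] to [B] lies in [tors_gen B], so it receives a nonzero
    map from [B]. The composite endomorphism of [B] is invertible, which makes [I -> B] epi and puts
    [B] in [U]. *)
Lemma sub_tors_gen_perp B U : brick B -> (U <= tors_gen B)%O ->
  ~ tors_set U B -> (U <= tors_perp [set B])%O.
Proof.
move=> bB /tors_leP UB nB; apply/le_tors_perp => _ -> M UM f.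
apply: contrapT => /hom_neq0_image[I [p [i [ep mi _ I0]]]].
have UI := torsion_quot (torsP U) ep UM.
have [g g0] := tors_gen_hom (UB _ UI) I0.
have ig : i \oc g <> 0 by rewrite -(cmpm0 _ i) => /mi.
apply: nB; case: bB => _ /(_ (i \oc g))[//|/iso_epi/epi_cmp_l ei].
exact: torsion_quot (torsP U) ei UI.
Qed.

Lemma brick_not_perp B : brick B -> ~ tors_set (tors_perp [set B]) B.
Proof. by move=> [B0 _] BB; apply: B0; apply/zero_objectP/BB. Qed.

(** If no member of [P] equals [tors_gen B], none contains [B], so all of them, and then their join,
    lie in the left perpendicular of [B], which does not contain [B]. *)
Lemma cjoin_irr_gen B : brick B -> cjoin_irr (tors_gen B).
Proof.
move=> bB P BP; apply: contrapT => nP; apply: (brick_not_perp bB).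
apply/tors_gen_le; rewrite [leLHS]BP; apply/bigjoin_le => V PV.
have VB : (V <= tors_gen B)%O by rewrite BP; exact: le_bigjoin.
apply: sub_tors_gen_perp => // /tors_gen_le BV; apply: nP.
by have -> : tors_gen B = V by apply/eqP; rewrite eq_le BV VB.
Qed.

Lemma lower_cover_gen B : brick B ->
  lower_cover (tors_gen B) = (tors_gen B `&` tors_perp [set B])%O.
Proof.
move=> bB; apply/eqP; rewrite eq_le; apply/andP; split.
  apply/bigjoin_le => V /= VB; rewrite lexI (ltW VB) /=.
  apply: sub_tors_gen_perp (ltW VB) _ => // /tors_gen_le BV.
  by have := lt_le_trans VB BV; rewrite ltxx.
apply: le_bigjoin => /=; rewrite lt_neqAle leIl andbT; apply/eqP => E.
apply: (brick_not_perp bB).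
by have := @tors_gen_mem B; rewrite -[in X in X -> _]E => /tors_meetP[].
Qed.

(** Let [T] satisfy the equation defining [kappa] and have a map to [B] with nonzero image [I]. As
    [B] is a brick, [Q = B/I] has no nonzero map to [B]; so [Q] lies in the lower cover, hence in
    [T], and so does the extension [B] of [Q] by [I], a contradiction. *)
Lemma kappa_gen B : brick B -> kappa (tors_gen B) = tors_perp [set B].
Proof.
move=> bB; rewrite /kappa (lower_cover_gen bB); set S := [set x | _ = _].
have maxB : maximums S (tors_perp [set B]).
  split=> //= T; rewrite /S /= => TE; apply/le_tors_perp => _ -> M TM f.
  apply: contrapT => /hom_neq0_image[I [p [i [ep mi _ I0]]]].
  have [Q [q iq]] := mono_ses mi; have eq := ses_epi iq.
  have TI := torsion_quot (torsP T) ep TM.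
  have : tors_set (tors_gen B `&` tors_perp [set B])%O Q.
    apply/tors_meetP; split.
      exact: torsion_quot (torsP _) eq (@tors_gen_mem B).
    move=> _ -> h; apply: contrapT => h0; apply: I0.
    have hq : h \oc q <> 0 by rewrite -(cmp0m _ q) => /eq.
    case: bB => _ /(_ (h \oc q))[//|/iso_mono/mono_cmp_r mq].
    apply: mono_zero (idm_mono (X := I)) _; apply/zero_objectP/mi/mq.
    by rewrite cmpm1 cmpm0 cmpm0 (ses_cmp0 iq).
  rewrite -TE => /tors_meetP[_ TQ].
  have TB := torsion_ext (torsP T) iq TI TQ.
  have : tors_set (tors_gen B `&` T)%O B.
    by apply/tors_meetP; split=> //; exact: tors_gen_mem.
  by rewrite TE => /tors_meetP[_]; exact: brick_not_perp.
(* A maximum exists, so [xget] returns one, and maxima are unique by antisymmetry. *)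
have [Sk kub] := xgetPex (tors_gen B) (ex_intro _ _ maxB).
by apply/eqP; rewrite eq_le maxB.2 //= kub //; exact: maxB.1.
Qed.

Definition brick_labels D : set (tors A) :=
  [set j | exists B, [/\ brick B, D B & j = tors_gen B]].

Context (hA : length_category A).

(** By filtration, [j] is the join of the classes generated by its bricks, so it is one of them. *)
Lemma cjoin_irr_brick (j : tors A) : cjoin_irr j ->
  exists2 B, brick B & j = tors_gen B.
Proof.
move=> /(_ (brick_labels (tors_set j)))[|B [bB _ ->]]; last by exists B.
apply/eqP; rewrite eq_le; apply/andP; split; last first.
  by apply/bigjoin_le => _ [B [_ jB ->]]; exact/tors_gen_le.
set J := bigjoin _; apply/tors_leP => M jM.
(* With the empty set as lower bound, the heart is all of [j]. *)
apply: (heart_filtration hA (torsP j) (sub0set _) (D := tors_set J)).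
- by case: (torsP J).
- by move=> Z; apply: torsion_zero; exact: torsP.
- move=> B [jB _] bB; apply/tors_gen_le; apply: le_bigjoin; exists B.
  by split.
- by split=> // X [].
Qed.

Lemma brick_labels_heart U T :
  brick_labels (heart (tors_set U) (tors_set T)) = j_label U T.
Proof.
apply/seteqP; split=> [_ [B [bB [TB UB] ->]]|j [/cjoin_irr_brick[B bB ->]]].
  split; [exact: cjoin_irr_gen|exact/tors_gen_le|].
  by rewrite kappa_gen //; apply/le_tors_perp => _ ->.
rewrite (kappa_gen bB) => /tors_gen_le TB /le_tors_perp/(_ B erefl) UB.
by exists B; split.
Qed.

(** The label [tors_gen B] remembers that [B] itself is in the heart: it lies below [T'] exactly if
    [T'] contains [B], and its [kappa] is the left perpendicular of [B]. Filtration passes from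
    bricks to all objects. *)
Lemma brick_labels_le (U T U' T' : tors A) : (U <= T)%O ->
  brick_labels (heart (tors_set U) (tors_set T)) `<=`
    brick_labels (heart (tors_set U') (tors_set T')) ->
  heart (tors_set U) (tors_set T) `<=` heart (tors_set U') (tors_set T').
Proof.
move=> /tors_leP UT sub; apply: heart_filtration => //; first exact: torsP.
- exact: heart_ext (torsP T').
- move=> Z Z0; split; first exact: torsion_zero (torsP T') Z0.
  by move=> X _ f; case: Z0 => Z0 _; exact: Z0.
move=> B hB bB; have := sub (tors_gen B); rewrite (brick_labels_heart U' T').
case=> [|_ /tors_gen_le TB]; first by exists B.
by rewrite kappa_gen // => /le_tors_perp/(_ B erefl).
Qed.

(** Reduces each of the three isomorphisms to identifying the hearts of a class of intervals. *)
Lemma heart_label_iso (P : set (set A)) (I : tors A -> tors A -> Prop) :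
  (forall U T, I U T -> (U <= T)%O) ->
  (forall H, P H <-> exists U T : tors A,
     I U T /\ H = heart (tors_set U) (tors_set T)) ->
  order_isomorphic P (j_labels I).
Proof.
move=> IW PE; exists brick_labels.
have mono : {in P &, {mono brick_labels : x y / (x <= y)%O}}.
  move=> H H' /set_mem/PE[U [T [/IW UT ->]]] /set_mem/PE[U' [T' [/IW UT' ->]]].
  apply/idP/idP; rewrite !subsetEset => s.
    exact: brick_labels_le.
  by move=> _ [B [bB /s hB ->]]; exists B.
split=> //; split.
- move=> H /PE[U [T [IUT ->]]]; exists U, T; split=> //.
  exact: brick_labels_heart.
- move=> H H' HP HP' E; apply/eqP; rewrite eq_le -!mono // E lexx //.
- move=> _ [U [T [IUT ->]]]; exists (heart (tors_set U) (tors_set T)).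
    by apply/PE; exists U, T.
  exact: brick_labels_heart.
Qed.

End BrickLabels.

(** * Covers of torsion classes; hearts of ICE and wide intervals *)

Section Intervals.
Context (A : abelianCat) (hA : length_category A).
Implicit Types (B X Y Z M : A) (C : set A) (T U V : tors A).

Lemma cokernel_precomp_epi W X Y Q (p : hom W X) (f : hom X Y) (q : hom Y Q) :
  is_epi p -> is_cokernel (f \oc p) q <-> is_cokernel f q.
Proof.
move=> ep; have kill Z (g : hom Y Z) : g \oc (f \oc p) = 0 <-> g \oc f = 0.
  by rewrite cmpA; split=> [/(proj1 (epiP p) ep)//|->]; rewrite cmp0m.
by split=> -[qf uq]; split=> [|Z g /kill/uq //]; apply/kill.
Qed.

Lemma right_perp_ses0 (D : set A) X Y Z (f : hom X Y) (g : hom Y Z) :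
  short_exact f g -> zero_object X -> right_perp D Z -> right_perp D Y.
Proof.
by move=> fg X0; apply: right_perp_sub; exact: kernel_mono_zero (proj1 fg) X0.
Qed.

(** The objects of [V] without nonzero maps to [Y] form a torsion class between [U] and [V] that
    omits [Y], so it equals [U]; and [X] is not in [U]. *)
Lemma cover_hom U V X Y : covered U V ->
  heart (tors_set U) (tors_set V) X -> heart (tors_set U) (tors_set V) Y ->
  ~ zero_object X -> ~ zero_object Y -> exists f : hom X Y, f <> 0.
Proof.
move=> [UV /(_ (tors_perp [set Y] `&` V)%O) cUV] [VX UX] [VY UY] X0 Y0.
apply: contrapT => nf; have UW : (U <= tors_perp [set Y] `&` V)%O.
  by rewrite lexI (ltW UV) andbT; apply/le_tors_perp => _ ->.
have WV : (tors_perp [set Y] `&` V < V)%O.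
  rewrite lt_neqAle leIr andbT; apply/eqP => E; apply: Y0.
  by move: VY; rewrite -E => /tors_meetP[YY _]; apply/zero_objectP/YY.
move: cUV; rewrite WV andbT lt_neqAle UW andbT negbK => /eqP UE.
apply: X0; apply: (zero_right_perp (T := tors_set U)) => //.
rewrite UE; apply/tors_meetP; split=> // _ -> f.
by apply: contrapT => f0; apply: nf; exists f.
Qed.

(* These are the simple objects of the wide subcategory [coker_perp U] below;
   they are exactly the brick labels of the covers of [U]. *)
Definition perp_simple U B : Prop :=
  [/\ ~ zero_object B, right_perp (tors_set U) B &
    forall Y (f : hom B Y), right_perp (tors_set U) Y -> f <> 0 ->
      is_mono f /\
      forall Q (q : hom Y Q), is_cokernel f q -> right_perp (tors_set U) Q].

Lemma cover_brick_simple U V B : covered U V -> brick B ->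
  heart (tors_set U) (tors_set V) B -> perp_simple U B.
Proof.
move=> cUV bB hB; have [B0 _] := bB; have [VB UB] := hB; split=> // Y f UY f0.
have mf : is_mono f.
  (* The image [I] is in the heart, so it maps nontrivially back to the brick [B], and [p] is split
     mono. *)
  have [I [p [i [ep mi fE I0]]]] := hom_neq0_image f0.
  have [g g0] := cover_hom cUV (heart_image (torsP V) ep mi VB UY) hB I0 B0.
  have gp : g \oc p <> 0 by rewrite -(cmp0m _ p) => /ep.
  have [h hp] := brick_retract bB gp; rewrite fE; apply: mono_cmp => //.
  by apply: (@mono_cmp_r _ _ _ _ _ h); rewrite hp; exact: idm_mono.
split=> // Q q cq; have fq := cokernel_ses mf cq.
(* The preimage [Y'] of the torsion part [N] of [Q] is in the heart. A nonzero map [Y' -> B] is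
   nonzero on [B], because [N] has no maps to [B]; so [B] splits off [Y'], [N] embeds in [Y'], and
   [N = 0]. *)
have [N [R [n [r [nr UN UR]]]]] := torsion_pair hA Q (torsP U).
have [Y' [y yk]] := epi_ses (epi_cmp (ses_epi fq) (ses_epi nr)).
have [a [b [ab _ _]]] :=
  ker_comp_ses (ses_epi fq) (proj1 fq) (proj1 yk) (proj1 nr).
have UY' := right_perp_sub (ses_mono yk) UY.
have hY' : heart (tors_set U) (tors_set V) Y'.
  split=> //; apply: torsion_ext (torsP V) ab VB _.
  by have /tors_leP := ltW cUV.1; apply.
have Y'0 : ~ zero_object Y' by move/(mono_zero (ses_mono ab)).
have [g g0] := cover_hom cUV hY' hB Y'0 B0.
have ga : g \oc a <> 0.
  move=> /(cokernel_desc (proj2 ab))[t tb]; apply: g0.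
  by rewrite -tb (UB _ UN t) cmp0m.
have [h ha] := brick_retract bB ga.
have [|s sb] := cokernel_desc (proj2 ab) (_ : (idm Y' - a \oc h) \oc a = 0).
  by rewrite cmpBl cmp1m -cmpA ha cmpm1 subrr.
have bs : b \oc s = idm N.
  apply: (ses_epi ab); rewrite -cmpA sb cmpBr cmpm1 cmpA (ses_cmp0 ab) cmp0m.
  by rewrite subr0 cmp1m.
have ms : is_mono s.
  by apply: (@mono_cmp_r _ _ _ _ _ b); rewrite bs; exact: idm_mono.
apply: right_perp_ses0 nr _ UR.
exact: zero_right_perp UN (right_perp_sub ms UY').
Qed.

Lemma cover_join_simple U (P : set (tors A)) X : (P `<=` covered U) ->
  tors_set (U `|` bigjoin P)%O X -> right_perp (tors_set U) X ->
  ~ zero_object X ->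
  exists V B (f : hom B X), [/\ P V, tors_set V B, perp_simple U B & f <> 0].
Proof.
move=> PU JX UX X0; have [V [PV VX]] := join_hom JX X0 UX.
have [M [g [VM g0]]] : exists M (g : hom M X), tors_set V M /\ g <> 0.
  apply: contrapT => nf; apply: VX => M VM g.
  by apply: contrapT => g0; apply: nf; exists M, g.
have [I [p [i [ep mi gE I0]]]] := hom_neq0_image g0.
have hI := heart_image (torsP V) ep mi VM UX.
have [B hB bB] := heart_exists_brick hA (torsP V) hI I0.
have [h h0] := cover_hom (PU _ PV) hB hI bB.1 I0.
exists V, B, (i \oc h); split=> //; first exact: hB.1.
  exact: cover_brick_simple (PU _ PV) bB hB.
by rewrite -(cmpm0 _ i) => /mi.
Qed.

(** Induction on the length of [X]: dividing [X] and [Y] by a relatively simple subobject [B] of [X]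
    keeps both in the right perpendicular of [U] and does not change [Q]. *)
Lemma join_covers_coker U X Y Q (f : hom X Y) (q : hom Y Q) :
  tors_set (U `|` bigjoin (covered U))%O X -> right_perp (tors_set U) X ->
  right_perp (tors_set U) Y -> short_exact f q -> right_perp (tors_set U) Q.
Proof.
have [n] := ubnP (objlen X).
elim: n => // n IHn in X Y f q *; rewrite ltnS => Xn JX UX UY fq.
have [X0|X0] := pselect (zero_object X).
  have mq := kernel_mono_zero (proj1 fq) X0.
  have [h [hq qh]] := mono_epi_iso mq (ses_epi fq).
  by apply: (right_perp_sub (i := h)) UY; apply: iso_mono; exists q.
have [V [B [j [PV VB [B0 UB sB] j0]]]] :=
  cover_join_simple (fun _ => id) JX UX X0.
have [mj cj] := sB _ j UX j0.
have [|_ cfj] := sB _ (f \oc j) UY.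
  by rewrite -(cmpm0 _ f) => /(ses_mono fq).
have [X1 [x jx]] := mono_ses mj; have [Y1 [y cy]] := abelian_cokernel (f \oc j).
have [a [b [ba _ _]]] := coker_comp_ses (ses_mono fq) (proj2 fq) cy (proj2 jx).
apply: (IHn _ _ _ _ _ _ (cj _ _ (proj2 jx)) (cfj _ _ cy) ba).
  by apply: leq_trans Xn; exact: objlen_ses_ltr jx B0.
exact: torsion_quot (torsP _) (ses_epi jx) JX.
Qed.

Lemma heart_subcategory U T : subcategory (heart (tors_set U) (tors_set T)).
Proof.
split=> [|X Y [f fi] [TX UX]].
  have [Z Z0] := abelian_zero A; exists Z; split.
    exact: torsion_zero (torsP T) Z0.
  by move=> X _ f; case: Z0 => Z0 _; exact: Z0.
split; first exact: torsion_quot (torsP T) (iso_epi fi) TX.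
have [g [gf fg]] := fi; apply: (right_perp_sub (i := g)) UX.
by apply: iso_mono; exists f.
Qed.

Lemma ice_interval_heart U T : ice_interval U T ->
  ice A (heart (tors_set U) (tors_set T)).
Proof.
move=> [_ /tors_leP TJ]; split; first exact: heart_subcategory.
- move=> X Y f [TX UX] [TY UY] I i /image_factor[mi [p [ep _]]].
  exact: heart_image (torsP T) ep mi TX UY.
- move=> X Y f [TX UX] [TY UY] Q q cq.
  split; first exact: torsion_quot (torsP T) (cokernel_epi cq) TY.
  have [I [p [i [ep mi fE]]]] := epi_mono_factor f.
  have [TI UI] := heart_image (torsP T) ep mi TX UY.
  move: cq; rewrite fE => /(cokernel_precomp_epi _ _ ep) cq.
  exact: join_covers_coker (TJ _ TI) UI UY (cokernel_ses mi cq).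
- exact: heart_ext (torsP T).
Qed.

Lemma wide_interval_ice U T : wide_interval U T -> ice_interval U T.
Proof.
move=> [UT TE]; split=> //; rewrite {1}TE leUx leUl /=.
by apply/bigjoin_le => V [cV _]; apply: le_trans (leUr _ _); exact: le_bigjoin.
Qed.

Lemma wide_interval_ker U T X Y K (f : hom X Y) (k : hom K X) :
  wide_interval U T -> heart (tors_set U) (tors_set T) X ->
  right_perp (tors_set U) Y -> is_kernel f k -> tors_set T K.
Proof.
move=> [UT TE]; have [n] := ubnP (objlen X).
elim: n => // n IHn in X Y K f k *; rewrite ltnS => Xn [TX UX] UY kf.
have mk := kernel_mono kf.
have [X0|X0] := pselect (zero_object X).
  exact: torsion_zero (torsP T) (mono_zero mk X0).
have PU : [set V | covered U V /\ (V <= T)%O] `<=` covered U by move=> V [].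
rewrite {1}TE in TX.
have [V [B [j [[cV VT] VB [B0 UB sB] j0]]]] := cover_join_simple PU TX UX X0.
rewrite -TE in TX.
have TB : tors_set T B by have /tors_leP := VT; apply.
have [mj cj] := sB _ j UX j0; have [X1 [x jx]] := mono_ses mj.
have hX1 : heart (tors_set U) (tors_set T) X1.
  split; first exact: torsion_quot (torsP T) (ses_epi jx) TX.
  exact: cj (proj2 jx).
have X1n : (objlen X1 < n)%N.
  by apply: leq_trans Xn; exact: objlen_ses_ltr jx B0.
have [fj|fj] := pselect (f \oc j = 0).
  (* If [f] kills [B], then [K] is an extension of the kernel of [X/B -> Y] by [B]. *)
  have [f1 f1x] := cokernel_desc (proj2 jx) fj.
  have [K1 [k1 kf1]] := abelian_kernel f1; rewrite -f1x in kf.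
  have [a [b [ab _ _]]] := ker_comp_ses (ses_epi jx) (proj1 jx) kf kf1.
  apply: torsion_ext (torsP T) ab TB _; exact: IHn X1n hX1 UY kf1.
(* Otherwise [K] meets [B] trivially and is the kernel of [X/B -> Y/f(B)]. *)
have [mfj cfj] := sB _ (f \oc j) UY fj.
have [Y1 [y cy]] := abelian_cokernel (f \oc j).
have [|f1 f1x] := cokernel_desc (proj2 jx) (_ : (y \oc f) \oc j = 0).
  by rewrite -cmpA; case: cy.
have kjE W (w : hom W K) (v : hom W B) : k \oc w = j \oc v -> w = 0.
  move=> E; have v0 : v = 0.
    apply: (proj1 (monoP _) mfj).
    by rewrite -cmpA -E cmpA (proj1 kf) cmp0m.
  by apply: (proj1 (monoP _) mk); rewrite E v0 cmpm0.
apply: IHn X1n hX1 (cfj _ _ cy) (_ : is_kernel f1 (x \oc k)).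
apply: kernel_intro_local.
- apply/monoP => W w; rewrite -cmpA => xkw.
  by have [v jv] := kernel_lift (proj1 jx) xkw; apply: kjE (esym jv).
- by rewrite cmpA f1x -cmpA (proj1 kf) cmpm0.
(* Lift [g] locally to [v] in [X]; then [f \oc v] comes from some [u] in [B], and [v - j \oc u] lies
   in [K]. *)
move=> W g f1g; have [W1 [e1 [v [ee1 xv]]]] := epi_lift g (ses_epi jx).
have [|u uE] :=
  kernel_lift (mono_kernel_coker mfj cy) (_ : y \oc (f \oc v) = 0).
  by rewrite cmpA -f1x -cmpA xv cmpA f1g cmp0m.
have [|h kh] := kernel_lift kf (_ : f \oc (v - j \oc u) = 0).
  by rewrite cmpBr cmpA uE subrr.
exists W1, e1, h; split=> //.
by rewrite -cmpA kh cmpBr cmpA (ses_cmp0 jx) cmp0m subr0.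
Qed.

Lemma wide_interval_heart U T : wide_interval U T ->
  wide A (heart (tors_set U) (tors_set T)).
Proof.
move=> UT; have [h1 _ h3 h4] := ice_interval_heart (wide_interval_ice UT).
split=> // X Y f hX [TY UY] K k kf; split.
  exact: wide_interval_ker UT hX UY kf.
by apply: right_perp_sub (kernel_mono kf) _; case: hX.
Qed.

End Intervals.

(** * The interval attached to an ICE-closed or wide subcategory *)

Section IceSubcategories.
Context (A : abelianCat) (hA : length_category A).
Implicit Types (B X Y Z M : A) (C E : set A) (T U V : tors A).

Lemma ice_zero C Z : ice A C -> zero_object Z -> C Z.
Proof.
move=> [[[X CX] isoC] _ cC _] Z0; apply: (cC _ _ (idm X) CX CX Z 0).
split=> [|W g]; first by rewrite cmpm1.
rewrite cmpm1 => ->; exists 0; split=> [|h _]; first by rewrite cmp0m.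
by case: Z0 => _ Z0; rewrite (Z0 _ h).
Qed.

Lemma wide_ice C : wide A C -> ice A C.
Proof.
move=> [sC eC kC cC]; split=> // X Y f CX CY I i [Q [q [cq ki]]].
exact: kC CY (cC _ _ _ CX CY _ _ cq) _ _ ki.
Qed.

(** A torsion class containing both [C] and [ice_bot C], used as an upper bound of [ice_top C]. *)
Definition quotients_in C : set A :=
  [set M | forall Y I (p : hom M I) (i : hom I Y),
     C Y -> is_epi p -> is_mono i -> C I].

(** For extensions, let [I] be a quotient of [M] inside [Y] in [C]. The image [I1] of [M1] is in
    [C], and [I/I1] is a quotient of [M2] inside [Y/I1], which is in [C]; so [I] is an extension of
    objects of [C]. *)
Lemma quotients_in_torsion C : ice A C -> torsion_class (quotients_in C).
Proof.
move=> iC; have [_ imC cC eC] := iC.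
have quo : quotient_closed (quotients_in C).
  move=> M M' r er DM Y I p i CY ep mi.
  exact: DM CY (epi_cmp er ep) mi.
split=> //.
  split=> [|X Y [f fi]]; last exact: quo (iso_epi fi).
  have [Z Z0] := abelian_zero A; exists Z => Y I p i _ ep _.
  exact: ice_zero iC (epi_zero ep Z0).
move=> M1 M M2 f g fg D1 D2 Y I p i CY ep mi.
have [I1 [p1 [j [ep1 mj pfE]]]] := epi_mono_factor (p \oc f).
have CI1 : C I1 by exact: D1 CY ep1 (mono_cmp mj mi).
have [J [c jc]] := mono_ses mj; have [Y1 [y cy]] := abelian_cokernel (i \oc j).
have [QI [qI cqI]] := abelian_cokernel i.
have [a [b [ba _ _]]] := coker_comp_ses mi cqI cy (proj2 jc).
have [|p2 p2g] := cokernel_desc (proj2 fg) (_ : (c \oc p) \oc f = 0).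
  by rewrite -cmpA pfE cmpA (ses_cmp0 jc) cmp0m.
have ep2 : is_epi p2.
  apply: (@epi_cmp_l _ _ _ _ g); rewrite p2g.
  exact: epi_cmp ep (ses_epi jc).
have CJ : C J by apply: D2 (cC _ _ _ CI1 CY _ _ cy) ep2 (ses_mono ba).
exact: eC jc CI1 CJ.
Qed.

Definition ice_bot C : tors A := tors_perp C.

(* The torsion class generated by [C] alone may be too small to be the upper
   bound of an interval with heart [C] when [C] is ICE-closed but not wide. *)
Definition ice_top C : tors A :=
  tors_inf [set T | C `<=` tors_set T /\ (ice_bot C <= T)%O].

Lemma ice_top_le C T :
  (ice_top C <= T)%O <-> C `<=` tors_set T /\ (ice_bot C <= T)%O.
Proof.
have [lb glb] := tors_infP [set T | C `<=` tors_set T /\ (ice_bot C <= T)%O].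
split=> [CT|]; last exact: lb.
split=> [X CX|]; first by move/tors_leP: CT; apply=> V [/(_ X CX)].
by apply: le_trans CT; apply: glb => V [].
Qed.

Lemma ice_bot_top C : (ice_bot C <= ice_top C)%O.
Proof. by have [/(_ (lexx _))[]] := ice_top_le C (ice_top C). Qed.

(* An object [M] of the heart has a largest quotient [M -> I] with [I] in [C]:
   its kernel [K] lies in [ice_bot C], since the image of [M] in the pushout
   along a nonzero [K -> Y], [Y] in [C], would be a larger one.  Hence [K = 0]. *)
Lemma ice_heart C : ice A C ->
  heart (tors_set (ice_bot C)) (tors_set (ice_top C)) = C.
Proof.
move=> iC; have [_ _ cC eC] := iC; apply/seteqP; split; last first.
  move=> X CX; have [/(_ (lexx _))[CT _] _] := ice_top_le C (ice_top C).
  by split; [exact: CT | move=> M UM f; exact: UM].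
move=> M [TM UM].
have DM : quotients_in C M.
  suff /tors_leP : (ice_top C <= Tors (mem_set (quotients_in_torsion iC)))%O.
    exact.
  apply/ice_top_le; split=> [X CX Y I p i CY ep mi|].
    by have [_ imC _ _] := iC; exact: imC CX CY _ _ (epi_mono_image ep mi).
  apply/tors_leP => X UX Y I p i CY ep mi.
  apply: ice_zero iC _; apply/zero_objectP/ep/mi.
  by rewrite cmp1m cmp0m cmpm0 (UX _ CY (i \oc p)).
pose P n := `[< exists I (p : hom M I), [/\ is_epi p, C I & objlen I = n] >].
have exP : exists n, P n.
  have [Z Z0] := abelian_zero A; exists (objlen Z); apply/asboolP.
  exists Z, 0; split=> //; [exact: epi_to_zero | exact: ice_zero iC Z0].
have ubP n : P n -> (n <= objlen M)%N.
  by move=> /asboolP[I [p [ep _ <-]]]; exact: (objlen_epi hA ep).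
case: (ex_maxnP exP ubP) => n /asboolP[I [p [ep CI In]]] maxn.
have [K [k kp]] := epi_ses ep.
have UK : tors_set (ice_bot C) K.
  move=> Y CY g; have [F [y [m [q [yq mk qm _]]]]] := pushout_ses g kp.
  have [I' [p' [i [ep' mi mE]]]] := epi_mono_factor m.
  have CI' : C I' := DM _ _ _ _ (eC _ _ _ _ _ yq CY CI) ep' mi.
  have eqi : is_epi (q \oc i).
    by apply: (@epi_cmp_l _ _ _ _ p'); rewrite -cmpA -mE qm.
  have iqi : is_iso (q \oc i).
    apply: (objlen_epi_iso hA) => //; rewrite In.
    by apply: maxn; apply/asboolP; exists I', p'.
  have p'k : p' \oc k = 0.
    apply: (proj1 (monoP _) (iso_mono iqi)).
    by rewrite cmpA -(cmpA q i) -mE qm (ses_cmp0 kp).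
  by apply: (ses_mono yq); rewrite -mk mE -cmpA p'k !cmpm0.
have K0 := zero_right_perp UK (right_perp_sub (ses_mono kp) UM).
have [[_ isoC] _ _ _] := iC; apply: isoC CI; apply: isomorphic_sym.
by exists p; apply: mono_epi_iso => //; exact: kernel_mono_zero (proj1 kp) K0.
Qed.

(** The dual, for a torsion-free class, of the Ingalls-Thomas wide subcategory of a torsion
    class. *)
Definition coker_perp U : set A := [set X | right_perp (tors_set U) X /\
  forall Y Q (f : hom X Y) (q : hom Y Q),
    right_perp (tors_set U) Y -> is_cokernel f q -> right_perp (tors_set U) Q].

(** Let [I] be the image of [f] and [N] the torsion part of [Q]. The preimage [Y'] of [N] is in the
    heart [C], so [N], the cokernel of [I -> Y'], is in [C]; being also in [ice_bot C], it is
    zero. *)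
Lemma ice_coker_perp C : ice A C -> C `<=` coker_perp (ice_bot C).
Proof.
move=> iC X CX; have CE := ice_heart iC; have [_ _ cC _] := iC.
have [TX UX] : heart (tors_set (ice_bot C)) (tors_set (ice_top C)) X.
  by rewrite CE.
split=> // Y Q f q UY cq; have [I [p [i [ep mi fE]]]] := epi_mono_factor f.
have hI := heart_image (torsP _) ep mi TX UY.
move: cq; rewrite fE => /(cokernel_precomp_epi _ _ ep) cq.
have iq := cokernel_ses mi cq.
have [N [R [n [r [nr UN UR]]]]] := torsion_pair hA Q (torsP (ice_bot C)).
have [Y' [y yk]] := epi_ses (epi_cmp (ses_epi iq) (ses_epi nr)).
have [a [b [ab _ _]]] :=
  ker_comp_ses (ses_epi iq) (proj1 iq) (proj1 yk) (proj1 nr).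
have CY' : C Y'.
  rewrite -CE; split; last exact: right_perp_sub (ses_mono yk) UY.
  apply: torsion_ext (torsP _) ab hI.1 _.
  by have /tors_leP := ice_bot_top C; apply.
have CN : C N by apply: cC CY' _ _ (proj2 ab); rewrite -CE.
apply: right_perp_ses0 nr _ UR; apply/zero_objectP; exact: UN.
Qed.

Lemma coker_perp_quot U X I (p : hom X I) : coker_perp U X -> is_epi p ->
  right_perp (tors_set U) I -> coker_perp U I.
Proof.
move=> [UX WX] ep UI; split=> // Y Q f q UY.
by move=> /(cokernel_precomp_epi _ _ ep); exact: WX.
Qed.

(** Take a shortest nonzero quotient [B] in the right perpendicular of [U]: the image of a nonzero
    map from [B] is no shorter, so the map is mono. *)
Lemma coker_perp_simple_quot U X : coker_perp U X -> ~ zero_object X ->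
  exists B (p : hom X B), is_epi p /\ perp_simple U B.
Proof.
move=> WX X0.
pose P n := `[< exists B (p : hom X B), [/\ is_epi p,
  right_perp (tors_set U) B, ~ zero_object B & objlen B = n] >].
have exP : exists n, P n.
  exists (objlen X); apply/asboolP; exists X, (idm X).
  by split=> //; [exact: idm_epi | case: WX].
case: (ex_minnP exP) => n /asboolP[B [p [ep UB B0 Bn]]] minn.
have [_ WB] := coker_perp_quot WX ep UB.
exists B, p; split=> //; split=> // Y f UY f0.
split; last by move=> Q q; exact: WB.
have [I [r [i [er mi fE I0]]]] := hom_neq0_image f0.
rewrite fE; apply: mono_cmp => //; apply/iso_mono/(objlen_epi_iso hA) => //.
rewrite Bn; apply: minn; apply/asboolP; exists I, (r \oc p).
by split=> //; [exact: epi_cmp | exact: right_perp_sub mi UY].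
Qed.

(** Push [g] out along [k]: the resulting map from [Y] has the same cokernel, and its target is an
    extension of [B] by [Z]. *)
Lemma coker_perp_ker U X Y B (k : hom X Y) (p : hom Y B) : short_exact k p ->
  coker_perp U Y -> right_perp (tors_set U) B -> coker_perp U X.
Proof.
move=> kp [UY WY] UB; split; first exact: right_perp_sub (ses_mono kp) UY.
move=> Z Q g q UZ cq.
have [F [z [m [r [zr mk rm up]]]]] := pushout_ses g kp.
have UF := right_perp_ext zr UZ UB.
have [|t [tz tm]] := up _ q 0; first by rewrite cmp0m (proj1 cq).
apply: WY UF (_ : is_cokernel m t); split=> // V h hm.
have [|s sq] := cokernel_desc cq (_ : (h \oc z) \oc g = 0).
  by rewrite -cmpA -mk cmpA hm cmp0m.
have et : is_epi t.
  by apply: (@epi_cmp_l _ _ _ _ z); rewrite tz; exact: cokernel_epi cq.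
have [|w wr] := cokernel_desc (proj2 zr) (_ : (s \oc t - h) \oc z = 0).
  by rewrite cmpBl -cmpA tz sq subrr.
have w0 : w = 0.
  apply: (proj1 (epiP _) (ses_epi kp)).
  by rewrite -rm cmpA wr cmpBl -cmpA tm hm cmpm0 subr0.
have st : s \oc t = h by apply/subr0_eq; rewrite -wr w0 cmp0m.
by exists s; split=> // s' s't; apply: et; rewrite s't.
Qed.

Lemma perp_simple_cover U B : perp_simple U B ->
  covered U (U `|` tors_gen B)%O.
Proof.
move=> [B0 UB sB]; split.
  rewrite lt_neqAle leUl andbT; apply/eqP => E; apply: B0.
  apply: zero_right_perp UB; apply/tors_gen_le; rewrite [leRHS]E; exact: leUr.
move=> V; apply/negP => /andP[UV VB].
(* Descent on [M]: it lies below the join, so [B] embeds in it, and the cokernel is a shorter such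
   object or zero. In the latter case [M] is isomorphic to [B], and [V] contains [B]. *)
have [n] : exists n, exists M, [/\ tors_set V M, right_perp (tors_set U) M,
    ~ zero_object M & (objlen M < n)%N].
  have [X VX UX] : exists2 X, tors_set V X & ~ tors_set U X.
    apply: contrapT => nX; have := lt_geF UV.
    suff -> : (V <= U)%O by [].
    apply/tors_leP => X VX; apply: contrapT => UX; apply: nX; by exists X.
  have [N [Q [i [q [iq UN UQ]]]]] := torsion_pair hA X (torsP U).
  exists (objlen Q).+1, Q; split=> //.
    exact: torsion_quot (torsP V) (ses_epi iq) VX.
  move=> Q0; apply: UX; apply: torsion_ext (torsP U) iq UN _.
  exact: torsion_zero (torsP U) Q0.
elim: n => [|n IHn] [M [VM UM M0]]; first by rewrite ltn0.
rewrite ltnS => Mn.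
have [f f0] : exists f : hom B M, f <> 0.
  apply: contrapT => nf; apply: M0.
  have : (U `|` tors_gen B <= tors_perp [set M])%O.
    rewrite leUx; apply/andP; split; first by apply/le_tors_perp => _ ->.
    apply/tors_gen_le => _ -> f; apply: contrapT => f0; apply: nf; by exists f.
  move/(le_trans (ltW VB))/tors_leP/(_ _ VM) => MM.
  by apply/zero_objectP/MM.
have [mf cf] := sB _ f UM f0; have [Q [q fq]] := mono_ses mf.
have [Q0|Q0] := pselect (zero_object Q); last first.
  apply: IHn; exists Q; split=> //.
  - exact: torsion_quot (torsP V) (ses_epi fq) VM.
  - exact: cf (proj2 fq).
  - by apply: leq_trans Mn; exact: objlen_ses_ltr fq B0.
have [h [hf fh]] := mono_epi_iso mf (cokernel_epi_zero (proj2 fq) Q0).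
have : (U `|` tors_gen B <= V)%O.
  rewrite leUx (ltW UV) /=; apply/tors_gen_le.
  by apply: (torsion_quot (p := h) (torsP V)) VM; apply: iso_epi; exists f.
by rewrite (lt_geF VB).
Qed.

(** Peels relatively simple quotients off the objects of [E]; applied with [E] the whole of
    [coker_perp U] for ICE intervals and with [E = C] for wide ones. *)
Lemma coker_perp_sub U E T : E `<=` coker_perp U ->
  (forall X Y B (k : hom X Y) (p : hom Y B), short_exact k p -> E Y ->
     perp_simple U B -> E X /\ tors_set T B) ->
  E `<=` tors_set T.
Proof.
move=> EW step X; have [n] := ubnP (objlen X).
elim: n => // n IHn in X *; rewrite ltnS => Xn EX.
have [X0|X0] := pselect (zero_object X); first exact: torsion_zero (torsP T) X0.
have [B [p [ep sB]]] := coker_perp_simple_quot (EW _ EX) X0.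
have [K [k kp]] := epi_ses ep; have [EK TB] := step _ _ _ _ _ kp EX sB.
apply: (torsion_ext (torsP T) kp _ TB); apply: IHn => //.
by apply: leq_trans Xn; case: sB => B0 _ _; exact: objlen_ses_ltl kp B0.
Qed.

Lemma ice_interval_of_ice C : ice A C ->
  ice_interval (ice_bot C) (ice_top C).
Proof.
move=> iC; split; first exact: ice_bot_top.
apply/ice_top_le; split; last exact: leUl.
apply: (subset_trans (ice_coker_perp iC)).
apply: (@coker_perp_sub (ice_bot C)) => //.
move=> X Y B k p kp WY sB; split.
  by have [_ UB _] := sB; exact: coker_perp_ker kp WY UB.
apply/tors_gen_le; apply: (le_trans (leUr _ (ice_bot C))).
by apply: (le_trans _ (leUr _ _)); apply: le_bigjoin; exact: perp_simple_cover.
Qed.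

Lemma wide_interval_of_wide C : wide A C ->
  wide_interval (ice_bot C) (ice_top C).
Proof.
move=> wC; have iC := wide_ice wC; have CE := ice_heart iC.
have [_ _ kC _] := wC; split; first exact: ice_bot_top.
apply/eqP; rewrite eq_le; apply/andP; split; last first.
  by rewrite leUx ice_bot_top /=; apply/bigjoin_le => V [].
apply/ice_top_le; split; last exact: leUl.
apply: coker_perp_sub (ice_coker_perp iC) _.
move=> X Y B k p kp CY sB; have [B0 UB _] := sB.
have TB : tors_set (ice_top C) B.
  apply: torsion_quot (torsP _) (ses_epi kp) _.
  by move: CY; rewrite -{1}CE => -[].
(* Kernel closure now keeps [X] in [C]; and since [B] is in [ice_top C], the cover it generates
   stays below [ice_top C]. *)
have CB : C B by rewrite -CE.
split; first exact: kC CY CB _ _ (proj1 kp).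
apply/tors_gen_le; apply: (le_trans (leUr _ (ice_bot C))).
apply: (le_trans _ (leUr _ _)); apply: le_bigjoin.
split; first exact: perp_simple_cover.
by rewrite leUx ice_bot_top /=; exact/tors_gen_le.
Qed.

End IceSubcategories.

Theorem theorem2 (A : abelianCat) (hA : length_category A) :
  [/\ order_isomorphic (tors_heart A) (j_labels (@any_interval _ (tors A))),
      order_isomorphic (wide A) (j_labels (@wide_interval _ (tors A))) &
      order_isomorphic (ice A) (j_labels (@ice_interval _ (tors A)))].
Proof.
split; apply: (heart_label_iso hA).
- by [].
- move=> H; split=> [[U [T [tU tT UT ->]]]|[U [T [UT ->]]]].
    exists (Tors (mem_set tU)), (Tors (mem_set tT)); split=> //.
    by apply/tors_leP.
  exists (tors_set U), (tors_set T).
  by split=> //; [exact: torsP | exact: torsP | exact/tors_leP].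
- by move=> U T [].
- move=> H; split=> [wH|[U [T [UT ->]]]]; last exact: wide_interval_heart.
  exists (ice_bot H), (ice_top H); split; first exact: wide_interval_of_wide.
  by rewrite ice_heart //; exact: wide_ice.
- by move=> U T [].
- move=> H; split=> [wH|[U [T [UT ->]]]]; last exact: ice_interval_heart.
  exists (ice_bot H), (ice_top H); split; first exact: ice_interval_of_ice.
  by rewrite ice_heart.
Qed.
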